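(* For every semi-deterministic MAC-IC-MAC with capacity region $\mathcal{C}^{\mathrm{sd}}$, $$\mathcal{C}^{\mathrm{sd}}\subseteq\mathcal{R}_{\mathrm{o}}^{\mathrm{sd}}:=\bigcup_{P_{\mathrm{o}}^{\mathrm{sd}}\in\mathcal{P}_{\mathrm{o}}^{\mathrm{sd}}}\mathcal{R}_{\mathrm{o}}^{\mathrm{sd}}(P_{\mathrm{o}}^{\mathrm{sd}}).$$
   Context: **Indices.** $K_1,K_2\ge 1$ are integers. For $i\in\{1,2\}$, $i'$ denotes the other element of $\{1,2\}$, and $\varTheta_i=\{i.1,\dots,i.K_i\}$. $\varUpsilon_i$ always denotes a subset of $\varTheta_i$ containing $i.1$; $\varOmega_i$ always denotes a non-empty subset of $\varTheta_i$; bars denote complements in $\varTheta_i$. For $S\subseteq\varTheta_i$, $X_S=(X_{i.j})_{i.j\in S}$ and $R(S)=\sum_{i.j\in S}R_{i.j}$. **Channel.** A semi-deterministic MAC-IC-MAC is a memoryless channel with $K_1+K_2$ transmitters Tx$i.j$ (discrete input alphabets $\mathcal{X}_{i.j}$) and two receivers Rx$i$ (discrete output alphabets $\mathcal{Y}_i$) in which, per channel use, $S_1,S_2$ (discrete alphabets $\mathcal{S}_1,\mathcal{S}_2$) are the outputs of independent discrete memoryless point-to-point channels $p_{S_i|X_{i.1}}(s_i|x_{i.1})$ with inputs $X_{1.1},X_{2.1}$, and $$Y_i=\phi_i(X_{\varTheta_i},S_{i'}),\qquad i=1,2,$$ where $\phi_i$ is a deterministic function such that for every fixed $x_{\varTheta_i}$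 the map $s_{i'}\mapsto\phi_i(x_{\varTheta_i},s_{i'})$ is invertible (one-to-one). Tx$i.j$ encodes a message $M_{i.j}$, uniform on $\{1,\dots,2^{nR_{i.j}}\}$ (messages independent), into $x_{i.j}^n(M_{i.j})$; Rx$i$ decodes all of $M_{\varTheta_i}$ from $Y_i^n$. A rate tuple $(R_{\varTheta_1},R_{\varTheta_2})\in\mathbb{R}_+^{K_1+K_2}$ is achievable if there are codes of these rates for which the probability that some message is decoded wrongly tends to $0$; the capacity region $\mathcal{C}^{\mathrm{sd}}$ is the closure of the set of achievable tuples. **Distributions.** $\mathcal{P}_{\mathrm{o}}^{\mathrm{sd}}$ is the set of joint distributions $P_{\mathrm{o}}^{\mathrm{sd}}$ of $(Q,T_1,X_{\varTheta_1},T_2,X_{\varTheta_2})$, with $T_i\in\mathcal{S}_i$ and $Q$ discrete, that factor as $$p(q)\,p_{S_1|X_{1.1}}(t_1|x_{1.1})\prod_{j=1}^{K_1}p(x_{1.j}|q)\;p_{S_2|X_{2.1}}(t_2|x_{2.1})\prod_{j=1}^{K_2}p(x_{2.j}|q).$$ $S_1,S_2,Y_1,Y_2$ are generated from the inputs by the channel, with $(T_1,T_2)$ conditionally independent of $(S_1,S_2)$ given the inputs. **Set functions.** Given $P_{\mathrm{o}}^{\mathrm{sd}}$, $$\overline{\mathsf{A}}_{\varUpsilon_i}=H(Y_i|X_{\bar\varUpsilon_i},T_i,X_{i'.1},Q)-H(S_{i'}|X_{i'.1},Q),$$ $$\overline{\mathsf{B}}_{\varOmega_i}=H(Y_i|X_{\bar\varOmega_i},X_{i'.1},Q)-H(S_{i'}|X_{i'.1},Q),$$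 $$\overline{\mathsf{E}}_{\varUpsilon_i}=H(Y_i|X_{\bar\varUpsilon_i},T_i,Q)-H(S_{i'}|X_{i'.1},Q),$$ $$\overline{\mathsf{G}}_{\varOmega_i}=H(Y_i|X_{\bar\varOmega_i},Q)-H(S_{i'}|X_{i'.1},Q).$$ **Region.** $\mathcal{R}_{\mathrm{o}}^{\mathrm{sd}}(P_{\mathrm{o}}^{\mathrm{sd}})$ is the set of $(R_{\varTheta_1},R_{\varTheta_2})\in\mathbb{R}_+^{K_1+K_2}$ such that for all admissible $\varUpsilon_1,\varOmega_1,\varUpsilon_2,\varOmega_2$: 1. $R(\varOmega_1)\le\overline{\mathsf{B}}_{\varOmega_1}$ 2. $R(\varOmega_2)\le\overline{\mathsf{B}}_{\varOmega_2}$ 3. $R(\varUpsilon_1)+R(\varOmega_2)\le\overline{\mathsf{A}}_{\varUpsilon_1}+\overline{\mathsf{G}}_{\varOmega_2}$ 4. $R(\varOmega_1)+R(\varUpsilon_2)\le\overline{\mathsf{G}}_{\varOmega_1}+\overline{\mathsf{A}}_{\varUpsilon_2}$ 5. $R(\varUpsilon_1)+R(\varUpsilon_2)\le\overline{\mathsf{E}}_{\varUpsilon_1}+\overline{\mathsf{E}}_{\varUpsilon_2}$ 6. $R(\varUpsilon_1)+R(\varOmega_1)+R(\varUpsilon_2)\le\overline{\mathsf{A}}_{\varUpsilon_1}+\overline{\mathsf{G}}_{\varOmega_1}+\overline{\mathsf{E}}_{\varUpsilon_2}$ 7. $R(\varUpsilon_1)+R(\varUpsilon_2)+R(\varOmega_2)\le\overline{\mathsf{E}}_{\varUpsilon_1}+\overline{\mathsf{A}}_{\varUpsilon_2}+\overline{\mathsf{G}}_{\varOmega_2}$.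 *)

(* Defs.v *)
From HB Require Import structures.
From mathcomp Require Import all_boot all_order all_algebra.
From mathcomp Require Import all_classical all_reals all_analysis.
Set Implicit Arguments.
Unset Strict Implicit.
Unset Printing Implicit Defensive.
Import Order.TTheory GRing.Theory Num.Theory.
Import numFieldNormedType.Exports.
Local Open Scope classical_set_scope.
Local Open Scope ring_scope.

Section FiniteEntropy.
Variable R : realType.

Definition is_pmf (A : finType) (p : A -> R) : Prop :=
  (forall a, 0 <= p a) /\ \sum_a p a = 1.

Definition log2 (x : R) : R := ln x / ln 2.

Definition law (W A : finType) (p : W -> R) (U : W -> A) (a : A) : R :=
  \sum_(w | U w == a) p w.

(* H(U|V) = - \sum_(a,b) p(a,b) log2 p(a|b).  Terms with p(a,b) = 0 vanish
   because of the factor p(a,b). *)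
Definition centropy (W A B : finType) (p : W -> R) (U : W -> A) (V : W -> B)
    : R :=
  - \sum_a \sum_b
      law p (fun w => (U w, V w)) (a, b) *
      log2 (law p (fun w => (U w, V w)) (a, b) / law p V b).

End FiniteEntropy.

(* The two cells are indexed by bool: false is cell 1, true is cell 2, so that
   i' is ~~ i.  Transmitter i.j is j : 'I_(ntx i), counted from 0: the
   transmitter i.1 is the ordinal 0, called [tx1 i] below. *)
Notation c1 := false (only parsing).
Notation c2 := true (only parsing).

Record sdmac (R : realType) := SdMac {
  ntx : bool -> nat;
  ntx_gt0 : forall i, (0 < ntx i)%N;
  inA : forall i, 'I_(ntx i) -> finType;
  sA : bool -> finType;
  outA : bool -> finType;
  pS : forall i, inA (Ordinal (ntx_gt0 i)) -> sA i -> R;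
  pS_pmf : forall i x, is_pmf (@pS i x);
  phi : forall i, {dffun forall j : 'I_(ntx i), inA j} -> sA (~~ i) -> outA i;
  phi_inj : forall i x, injective (@phi i x)
}.

Section Channel.
Variables (R : realType) (C : sdmac R).

Definition tx1 (i : bool) : 'I_(ntx C i) := Ordinal (ntx_gt0 C i).

(* Alphabet of X_{Theta_i}, of (X_{Theta_1}, X_{Theta_2}) and of (S_1, S_2). *)
Definition cell_input (i : bool) : finType :=
  {dffun forall j : 'I_(ntx C i), inA j}.
Definition input : finType := {dffun forall i : bool, cell_input i}.
Definition svec : finType := {dffun forall i : bool, sA C i}.

Definition pSS (x : input) (s : svec) : R :=
  \prod_(i : bool) pS (x i (tx1 i)) (s i).

Definition output (x : input) (s : svec) (i : bool) : outA C i :=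
  phi (x i) (s (~~ i)).

(* Rate tuples (R_{Theta_1}, R_{Theta_2}), with the product topology. *)
Definition rates : Type := ('rV[R]_(ntx C c1) * 'rV[R]_(ntx C c2))%type.

Definition rate (r : rates) (i : bool) : 'I_(ntx C i) -> R :=
  match i return 'I_(ntx C i) -> R with
  | c1 => fun j => r.1 ord0 j
  | c2 => fun j => r.2 ord0 j
  end.

Definition rate_nneg (r : rates) : Prop := forall i j, 0 <= @rate r i j.

(* Number of integers in {1, ..., 2^{n rho}}, i.e. the floor of 2^{n rho}. *)
Definition nmsg (n : nat) (rho : R) : nat := Num.truncn (2 `^ (n%:R * rho)).

Section Codes.
Variables (n : nat) (r : rates).

Definition msg (i : bool) (j : 'I_(ntx C i)) : finType :=
  'I_(nmsg n (rate r j)).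
Definition msgs : finType :=
  {dffun forall i : bool, {dffun forall j : 'I_(ntx C i), msg j}}.

Record code := Code {
  enc : forall i (j : 'I_(ntx C i)), msg j -> {ffun 'I_n -> inA j};
  dec : forall i, {ffun 'I_n -> outA C i} -> forall j : 'I_(ntx C i), msg j
}.

Variable c : code.

Definition sent (m : msgs) (t : 'I_n) : input :=
  [ffun i : bool => [ffun j : 'I_(ntx C i) => enc c (m i j) t] : cell_input i].

Definition received (m : msgs) (s : {ffun 'I_n -> svec}) (i : bool)
    : {ffun 'I_n -> outA C i} :=
  [ffun t => output (sent m t) (s t) i].

Definition wrong (m : msgs) (s : {ffun 'I_n -> svec}) : bool :=
  [exists i, exists j, dec c (received m s i) j != m i j].

Definition error_prob : R :=
  (#|msgs|%:R)^-1 *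
  \sum_(m : msgs) \sum_(s : {ffun 'I_n -> svec} | wrong m s)
     \prod_(t < n) pSS (sent m t) (s t).

End Codes.

Definition achievable (r : rates) : Prop :=
  rate_nneg r /\
  exists c : forall n, code n r, (fun n => error_prob (c n)) @ \oo --> (0 : R).

Definition capacity_region : set rates := closure [set r | achievable r].

Section OuterBound.
Variable Q : finType.

(* Values (q, (t_1, t_2), (x_{Theta_1}, x_{Theta_2})). *)
Definition po_space : finType := (Q * svec * input)%type.

Definition is_Po (P : po_space -> R) : Prop :=
  exists (pQ : Q -> R) (pX : forall i (j : 'I_(ntx C i)), Q -> inA j -> R),
    [/\ is_pmf pQ,
        forall i (j : 'I_(ntx C i)) q, is_pmf (@pX i j q) &
        forall q t x, P (q, t, x) =
          pQ q * \prod_(i : bool)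
            (pS (x i (tx1 i)) (t i) *
             \prod_(j < ntx C i) @pX i j q (x i j))].

Variable P : po_space -> R.

(* Joint law of (Q, T, X) and (S_1, S_2): the latter is drawn from the inputs
   by the channel, conditionally independently of T. *)
Definition full_space : finType := (po_space * svec)%type.
Definition full_law (w : full_space) : R := P w.1 * pSS w.1.2 w.2.

Definition rvQ (w : full_space) : Q := w.1.1.1.
Definition rvT (i : bool) (w : full_space) : sA C i := w.1.1.2 i.
Definition rvX (i : bool) (j : 'I_(ntx C i)) (w : full_space) : inA j :=
  w.1.2 i j.
Definition rvS (i : bool) (w : full_space) : sA C i := w.2 i.
Definition rvY (i : bool) (w : full_space) : outA C i := output w.1.2 w.2 i.

Definition rvXS (i : bool) (D : {set 'I_(ntx C i)}) (w : full_space)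
    : {dffun forall j : {j : 'I_(ntx C i) | j \in D}, inA (val j)} :=
  [ffun j : {j : 'I_(ntx C i) | j \in D} => rvX (val j) w].

Definition HS (i : bool) : R :=
  centropy full_law (rvS i) (fun w => (rvX (tx1 i) w, rvQ w)).

Definition bndA (i : bool) (U : {set 'I_(ntx C i)}) : R :=
  centropy full_law (rvY i)
    (fun w => (rvXS (~: U) w, rvT i w, rvX (tx1 (~~ i)) w, rvQ w))
  - HS (~~ i).

Definition bndB (i : bool) (O : {set 'I_(ntx C i)}) : R :=
  centropy full_law (rvY i)
    (fun w => (rvXS (~: O) w, rvX (tx1 (~~ i)) w, rvQ w))
  - HS (~~ i).

Definition bndE (i : bool) (U : {set 'I_(ntx C i)}) : R :=
  centropy full_law (rvY i) (fun w => (rvXS (~: U) w, rvT i w, rvQ w))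
  - HS (~~ i).

Definition bndG (i : bool) (O : {set 'I_(ntx C i)}) : R :=
  centropy full_law (rvY i) (fun w => (rvXS (~: O) w, rvQ w))
  - HS (~~ i).

Definition rsum (r : rates) (i : bool) (D : {set 'I_(ntx C i)}) : R :=
  \sum_(j in D) rate r j.

Definition Ro (r : rates) : Prop :=
  rate_nneg r /\
  forall (U1 O1 : {set 'I_(ntx C c1)}) (U2 O2 : {set 'I_(ntx C c2)}),
    tx1 c1 \in U1 -> O1 != finset.set0 ->
    tx1 c2 \in U2 -> O2 != finset.set0 ->
    [/\ rsum r O1 <= bndB O1,
        rsum r O2 <= bndB O2,
        rsum r U1 + rsum r O2 <= bndA U1 + bndG O2,
        rsum r O1 + rsum r U2 <= bndG O1 + bndA U2 &
    [/\ rsum r U1 + rsum r U2 <= bndE U1 + bndE U2,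
        rsum r U1 + rsum r O1 + rsum r U2 <= bndA U1 + bndG O1 + bndE U2 &
        rsum r U1 + rsum r U2 + rsum r O2 <= bndE U1 + bndA U2 + bndG O2]].

End OuterBound.

Definition outer_region : set rates :=
  [set r | exists (Q : finType) (P : po_space Q -> R), is_Po P /\ Ro P r].

End Channel.

Arguments capacity_region {R} C _.
Arguments outer_region {R} C _.

(* Main.v *)
(* Converse for a block code of length n.  In each cell a genie may hand the
   receiver T_i^n, a copy of S_i^n drawn independently from the same codeword,
   and may reveal the interfering codeword X_{i'.1}^n.  Since Y_i^n determines
   S_{i'}^n once the inputs of cell i are known, Fano's inequality gives, up to
   o(n), the four bounds A, B, E, G on n R(D), each perturbed by a combination
   of the n-letter excesses
     H(S_i^n) - \sum_t H(S_{i,t} | X_{i.1,t}),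
   and these excesses cancel in each of the seven inequalities of the region.
   The time index plays the role of Q.
   The capacity region is a closure, so the inequalities first hold up to every
   eps > 0.  By Caratheodory's theorem the alphabet of Q can be taken of a fixed
   size; the distributions then have a limit along an ultrafilter, and the
   bounds are continuous in the distribution. *)

From HB Require Import structures.
From mathcomp Require Import all_boot all_order all_algebra.
From mathcomp Require Import all_classical all_reals all_analysis.
From mathcomp Require Import ring lra.
Require Import Defs.
Set Implicit Arguments.
Unset Strict Implicit.
Unset Printing Implicit Defensive.
Import Order.TTheory GRing.Theory Num.Theory.
Import numFieldNormedType.Exports.
Local Open Scope classical_set_scope.
Local Open Scope ring_scope.

(** * Sums over finite products *)

(** The four bounds cannot be brought to single letters one at a time. Let e_i be the excess of cell
    i; it equals I(M_i; S_i^n) and may be of order n. Handing out T_i^n costs at most e_i, and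
    hiding X_{i'.1}^n subtracts H(S_{i'}^n), which exceeds its single-letter part by e_{i'}. The
    offsets of A, B, E, G are therefore e_i, 0, e_i - e_{i'} and -e_{i'}, and they vanish exactly in
    B_i, A_i + G_{i'}, E_1 + E_2 and A_i + G_i + E_{i'}. The bounds on conditional entropies from
    above rest on a single one: conditional entropy is at most the cross-entropy with respect to any
    sub-stochastic kernel. Conditioning, splitting over time, Fano and the memoryless channel differ
    only in the kernel. As eps shrinks the block length grows, and with it the alphabet of the time
    index, so there is no compactness to start with. A mixture enters the region only through its
    vector of averaged bounds, whose dimension is fixed, and this is what Caratheodory's theorem
    exploits. *)

Section ProductSums.
Variables (R : comNzRingType) (I : finType) (T : I -> finType).

Lemma sum_dffun_prod (F : forall i, T i -> R) :
  \sum_(f : {dffun forall i, T i}) \prod_i F i (f i) = \prod_i \sum_x F i x.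
Proof.
(* Recoding dependent functions as [fprod] puts all their values in one tagged union, where
   distributivity over functions with a common codomain applies. *)
rewrite (reindex (@dffun_of_fprod I T)); last exact/onW_bij/dffun_of_fprod_bij.
under eq_bigr do under eq_bigr do rewrite ffunE.
pose G i : {ffun T i -> R} := [ffun x => F i x].
transitivity (\sum_(t : fprod T) \prod_(i in I) G i (t i)).
  by apply: eq_bigr => t _; apply: eq_bigr => i _; rewrite ffunE.
rewrite big_fprod.
transitivity (\prod_i \sum_(j in tagged_with T i) untag 0 (G i) j).
  by rewrite bigA_distr_big_dep.
apply: eq_bigr => i _; rewrite -(big_tag (fun i x => G i x) i).
by apply: eq_bigr => x _; rewrite ffunE.
Qed.

Lemma sum_dffun_prod_cond (P : forall i, pred (T i)) (F : forall i, T i -> R) :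
  \sum_(f : {dffun forall i, T i} | [forall i, P i (f i)]) \prod_i F i (f i) =
  \prod_i \sum_(x | P i x) F i x.
Proof.
under [RHS]eq_bigr do rewrite big_mkcond.
rewrite -sum_dffun_prod big_mkcond; apply: eq_bigr => f _.
case: ifPn => [/forallP Pf|/forallPn [i nPi]].
  by apply: eq_bigr => i _; rewrite Pf.
by rewrite (bigD1 i) //= (negPf nPi) mul0r.
Qed.

Lemma card_dffunR :
  #|{dffun forall i, T i}|%:R = \prod_i #|T i|%:R :> R.
Proof.
transitivity (\sum_(f : {dffun forall i, T i}) 1 : R).
  by rewrite sumr_const.
transitivity (\sum_(f : {dffun forall i, T i}) \prod_(i : I) 1 : R).
  by apply: eq_bigr => f _; rewrite big1.
rewrite (sum_dffun_prod (fun i (x : T i) => 1)).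
by apply: eq_bigr => i _; rewrite sumr_const.
Qed.

End ProductSums.

(** * Entropy on finite probability spaces *)

Section Entropy.
Variable R : realType.
Implicit Types W A B D : finType.

Lemma log2M (x y : R) : 0 < x -> 0 < y -> log2 (x * y) = log2 x + log2 y.
Proof. by move=> x0 y0; rewrite /log2 lnM ?posrE // mulrDl. Qed.

Lemma log2V (x : R) : 0 < x -> log2 x^-1 = - log2 x.
Proof. by move=> x0; rewrite /log2 lnV ?posrE // mulNr. Qed.

Lemma log2_div (x y : R) : 0 < x -> 0 < y -> log2 (x / y) = log2 x - log2 y.
Proof. by move=> x0 y0; rewrite log2M ?invr_gt0 // log2V. Qed.

Lemma log2_1 : log2 1 = 0 :> R.
Proof. by rewrite /log2 ln1 mul0r. Qed.

Lemma ln2_gt0 : 0 < ln 2 :> R.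
Proof. by rewrite ln_gt0 // ltr1n. Qed.

Lemma log2_2 : log2 2 = 1 :> R.
Proof. by rewrite /log2 divff // gt_eqF // ln2_gt0. Qed.

Lemma ler_log2 (x y : R) : 0 < x -> x <= y -> log2 x <= log2 y.
Proof.
move=> x0 xy; rewrite /log2 ler_pM2r ?invr_gt0 ?ln2_gt0 //.
by rewrite ler_ln // posrE // (lt_le_trans x0).
Qed.

Lemma log2_ge0 (x : R) : 1 <= x -> 0 <= log2 x.
Proof. by move=> x1; rewrite -log2_1 ler_log2. Qed.

Lemma log2_prod (I : finType) (P : pred I) (F : I -> R) :
  (forall i, P i -> 0 < F i) ->
  log2 (\prod_(i | P i) F i) = \sum_(i | P i) log2 (F i).
Proof.
move=> F0; suff [_ //] : 0 < \prod_(i | P i) F i /\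
   log2 (\prod_(i | P i) F i) = \sum_(i | P i) log2 (F i).
elim/big_rec2: _ => [|i y1 y2 Pi [y0 <-]]; first by rewrite log2_1.
by rewrite mulr_gt0 ?F0 // log2M ?F0.
Qed.

Lemma ln_le_sub1 (x : R) : 0 < x -> ln x <= x - 1.
Proof. by move=> x0; rewrite -{1}(subrKC 1 x) le_ln1Dx // ltrBrDl subrr. Qed.

Section Law.
Variables (W : finType) (p : W -> R).

Lemma sum_law A (U : W -> A) (f : A -> R) :
  \sum_a law p U a * f a = \sum_w p w * f (U w).
Proof.
rewrite (partition_big U predT) //=; apply: eq_bigr => a _.
by rewrite /law mulr_suml; apply: eq_bigr => w /eqP ->.
Qed.

Lemma law_total A (U : W -> A) : \sum_a law p U a = \sum_w p w.
Proof.
have := sum_law U (fun=> 1).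
by under eq_bigr do rewrite mulr1; under [in RHS]eq_bigr do rewrite mulr1.
Qed.

Lemma law_comp A B (U : W -> A) (V : A -> B) :
  law (law p U) V =1 law p (V \o U).
Proof.
move=> b; rewrite /law [RHS](partition_big U (fun a => V a == b)) //=.
apply: eq_bigr => a /eqP Vab; apply: eq_bigl => w.
by case: (U w =P a) => [->|]; rewrite ?andbT ?Vab ?eqxx ?andbF.
Qed.

Lemma law_marg A B (U : W -> A) (V : W -> B) b :
  \sum_a law p (fun w => (U w, V w)) (a, b) = law p V b.
Proof.
rewrite /law [RHS](partition_big U predT) //=; apply: eq_bigr => a _.
by apply: eq_bigl => w; rewrite xpair_eqE andbC.
Qed.

Lemma law_refine A B (U : W -> A) (V : W -> B) w :
  (forall w w', (U w == U w') = (V w == V w')) ->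
  law p U (U w) = law p V (V w).
Proof. by move=> UV; apply: eq_bigl => w'; rewrite UV. Qed.

Hypothesis p_ge0 : forall w, 0 <= p w.

Lemma law_ge0 A (U : W -> A) a : 0 <= law p U a.
Proof. exact: sumr_ge0. Qed.

Lemma law_gt0 A (U : W -> A) w : 0 < p w -> 0 < law p U (U w).
Proof.
by move=> pw; rewrite /law (bigD1 w) //= ltr_pwDl // sumr_ge0.
Qed.

Lemma le_law A B (U : W -> A) (V : W -> B) w :
  (forall w', U w' = U w -> V w' = V w) ->
  law p U (U w) <= law p V (V w).
Proof.
move=> UV; rewrite /law [leLHS]big_mkcond [leRHS]big_mkcond /= ler_sum // => w' _.
by case: eqP => [/UV ->|_]; rewrite ?eqxx //; case: ifP.
Qed.

End Law.

Definition ent W A (p : W -> R) (U : W -> A) : R :=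
  - \sum_w p w * log2 (law p U (U w)).

(* Joint minus marginal entropy: the terms of [centropy] at atoms of mass zero
   need no separate treatment in this form. *)
Definition cent W A B (p : W -> R) (U : W -> A) (V : W -> B) : R :=
  ent p (fun w => (U w, V w)) - ent p V.

Lemma entE W A (p : W -> R) (U : W -> A) :
  ent p U = - \sum_a law p U a * log2 (law p U a).
Proof. by rewrite /ent (sum_law p U (fun a => log2 (law p U a))). Qed.

Lemma ent_law W A B (p : W -> R) (U : W -> A) (V : A -> B) :
  ent (law p U) V = ent p (V \o U).
Proof.
by rewrite !entE; congr (- _); apply: eq_bigr => b _; rewrite !law_comp.
Qed.

Lemma cent_law W A B D (p : W -> R) (U : W -> A) (V : A -> B) (Z : A -> D) :
  cent (law p U) V Z = cent p (V \o U) (Z \o U).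
Proof. by rewrite /cent !ent_law. Qed.

Lemma eq_ent_law W A (p p' : W -> R) (U : W -> A) :
  p =1 p' -> ent p U = ent p' U.
Proof.
move=> pp'; rewrite !entE; congr (- _); apply: eq_bigr => b _.
by rewrite /law; under eq_bigr do rewrite pp'.
Qed.

Lemma eq_cent_law W A B (p p' : W -> R) (U : W -> A) (V : W -> B) :
  p =1 p' -> cent p U V = cent p' U V.
Proof. by move=> pp'; congr (_ - _); apply: eq_ent_law. Qed.

(** Entropy sees only the partition into fibres. Boolean equalities let [xpair_eqE] discharge the
    hypothesis for tuples. *)
Lemma ent_equiv W A B (p : W -> R) (U : W -> A) (V : W -> B) :
  (forall w w', (U w == U w') = (V w == V w')) -> ent p U = ent p V.
Proof.
move=> UV; congr (- _); apply: eq_bigr => w _.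
by rewrite (law_refine p w UV).
Qed.

(** The conditioned variables have to agree only inside each fibre of [V]. *)
Lemma cent_equiv W A B D (E : finType) (p : W -> R)
    (U : W -> A) (V : W -> B) (U' : W -> D) (V' : W -> E) :
  (forall w w', (V w == V w') = (V' w == V' w')) ->
  (forall w w', V w = V w' -> (U w == U w') = (U' w == U' w')) ->
  cent p U V = cent p U' V'.
Proof.
move=> VV UU; congr (_ - _); apply: ent_equiv => // w w'.
rewrite !xpair_eqE -VV; case: (V w =P V w') => [/UU ->|] //.
by rewrite !andbF.
Qed.

Lemma centropyE W A B (p : W -> R) (U : W -> A) (V : W -> B) :
  (forall w, 0 <= p w) -> centropy p U V = cent p U V.
Proof.
move=> p0; rewrite /centropy pair_big /= /cent /ent opprK addrC -opprB.
congr (- _); set L := law p (fun w => _).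
rewrite (eq_bigr (fun ab => L ab * log2 (L ab / law p V ab.2))); last by case.
rewrite (sum_law p _ (fun ab => log2 (L ab / law p V ab.2))) -sumrB.
apply: eq_bigr => w _; rewrite -mulrBr.
have := p0 w; rewrite le_eqVlt => /predU1P [<-|pw]; first by rewrite !mul0r.
by rewrite log2_div ?law_gt0 // (law_gt0 p0).
Qed.

Section Inequalities.
Variables (W : finType) (p : W -> R).
Hypothesis p_ge0 : forall w, 0 <= p w.

(** This is ln x <= x - 1 at x = k(U|V) p(V) / p(U,V), averaged over [p]; the average of x is at
    most 1 because [k] is sub-stochastic. *)
Lemma gibbs A B (U : W -> A) (V : W -> B) (k : B -> A -> R) :
  (forall b a, 0 <= k b a) -> (forall b, \sum_a k b a <= 1) ->
  (forall w, 0 < p w -> 0 < k (V w) (U w)) ->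
  cent p U V <= - \sum_w p w * log2 (k (V w) (U w)).
Proof.
move=> k0 k1 kp; set L := law p (fun w => (U w, V w)).
rewrite -subr_le0 opprK.
have step w : p w * log2 (law p V (V w)) - p w * log2 (L (U w, V w)) +
    p w * log2 (k (V w) (U w)) <=
    (p w * (k (V w) (U w) * law p V (V w) / L (U w, V w)) - p w) / ln 2.
  have := p_ge0 w; rewrite le_eqVlt => /predU1P [<-|pw].
    by rewrite !mul0r subrr addr0 mul0r.
  have l1 := law_gt0 p_ge0 V pw.
  have l2 : 0 < L (U w, V w) := law_gt0 p_ge0 (fun w => (U w, V w)) pw.
  have kw := kp _ pw.
  rewrite (_ : _ + _ = p w * (log2 (k (V w) (U w)) + log2 (law p V (V w)) -
    log2 (L (U w, V w)))); last by ring.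
  rewrite [leRHS](_ : _ = p w * ((k (V w) (U w) * law p V (V w) / L (U w, V w) - 1)
    / ln 2)); last by ring.
  rewrite ler_pM2l // -log2M // -log2_div ?mulr_gt0 //.
  by rewrite ler_pM2r ?invr_gt0 ?ln2_gt0 // ln_le_sub1 // divr_gt0 ?mulr_gt0.
have -> : cent p U V + \sum_w p w * log2 (k (V w) (U w)) =
  \sum_w (p w * log2 (law p V (V w)) - p w * log2 (L (U w, V w)) +
    p w * log2 (k (V w) (U w))).
  by rewrite big_split sumrB /= /cent /ent opprK [X in X + _]addrC.
apply: (le_trans (ler_sum _ (fun w _ => step w))).
rewrite -mulr_suml pmulr_lle0 ?invr_gt0 ?ln2_gt0 // sumrB subr_le0.
rewrite -(sum_law p (fun w => (U w, V w))
  (fun ab => k ab.2 ab.1 * law p V ab.2 / L ab)).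
rewrite -(law_total p V) -(pair_big xpredT xpredT
  (fun a b => L (a, b) * (k b a * law p V b / L (a, b)))) exchange_big /=.
apply: ler_sum => b _; rewrite -[leRHS]mul1r.
apply: (@le_trans _ _ (\sum_a k b a * law p V b)).
  (* On atoms of mass zero the left side vanishes while the kernel may not, so only an inequality
     holds. *)
  apply: ler_sum => a _; have [->|n0] := eqVneq (L (a, b)) 0.
    by rewrite mul0r mulr_ge0 // law_ge0.
  by rewrite mulrC divfK.
by rewrite -mulr_suml ler_wpM2r // law_ge0.
Qed.

Lemma cent_ge0 A B (U : W -> A) (V : W -> B) : 0 <= cent p U V.
Proof.
rewrite /cent /ent opprK addrC -sumrB sumr_ge0 // => w _; rewrite -mulrBr.
have := p_ge0 w; rewrite le_eqVlt => /predU1P [<-|pw]; first by rewrite mul0r.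
rewrite mulr_ge0 // subr_ge0 ler_log2 ?(law_gt0 p_ge0 (fun w => (U w, V w))) //.
by apply: (le_law p_ge0 (U := fun w => (U w, V w))) => w' [].
Qed.

Lemma refine_fun A B (V : W -> A) (V' : W -> B) :
  (0 < #|W|)%N -> (forall w w', V w = V w' -> V' w = V' w') ->
  exists h, V' =1 h \o V.
Proof.
case/card_gt0P => w0 _ VV'.
exists (fun a => V' (odflt w0 [pick w | V w == a])) => w /=.
by case: pickP => [w' /eqP/VV' ->|/(_ w)] //; rewrite eqxx.
Qed.

(* [k] is the conditional law of [U] given the coarser [V']. *)
Lemma cent_coarsen A B D (U : W -> A) (V : W -> B) (V' : W -> D) :
  (0 < #|W|)%N -> (forall w w', V w = V w' -> V' w = V' w') ->
  cent p U V <= cent p U V'.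
Proof.
move=> W0 /(refine_fun W0) [h hV].
pose k b a := law p (fun w => (U w, V' w)) (a, h b) / law p V' (h b).
have L0 : forall ad, 0 <= law p (fun w => (U w, V' w)) ad by exact: law_ge0.
have L0' : forall d, 0 <= law p V' d by exact: law_ge0.
have l1 w : 0 < p w -> 0 < law p (fun w => (U w, V' w)) (U w, V' w).
  exact: (law_gt0 p_ge0 (fun w => (U w, V' w))).
have l2 w : 0 < p w -> 0 < law p V' (V' w) by exact: law_gt0.
have E : cent p U V' = - \sum_w p w * log2 (k (V w) (U w)).
  rewrite /cent /ent -opprD -sumrN -big_split /=; congr (- _).
  apply: eq_bigr => w _; rewrite -mulrN -mulrDr.
  have := p_ge0 w; rewrite le_eqVlt => /predU1P [<-|pw]; first by rewrite !mul0r.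
  by rewrite /k -[h (V w)]/((h \o V) w) -hV log2_div ?l1 ?l2.
rewrite E; apply: gibbs => [b a|b|w pw].
- by rewrite divr_ge0.
- rewrite -mulr_suml law_marg; have [->|n0] := eqVneq (law p V' (h b)) 0.
    by rewrite mul0r.
  by rewrite divff.
- rewrite /k -[h (V w)]/((h \o V) w) -hV divr_gt0 ?l1 ?l2 //.
Qed.

(** Gibbs with the product over t of the conditional laws of U_t given V_t, whose cross-entropy is
    exactly the right-hand side. This replaces the chain rule followed by dropping conditions. *)
Lemma cent_vector n (A B : finType) (U : W -> {ffun 'I_n -> A}) (V : W -> B)
    (Z : 'I_n -> finType) (Vt : forall t, W -> Z t) :
  (0 < #|W|)%N -> (forall t w w', V w = V w' -> Vt t w = Vt t w') ->
  cent p U V <= \sum_t cent p (fun w => U w t) (Vt t).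
Proof.
move=> W0 VV.
have hE t : {h | Vt t =1 h \o V}.
  by apply: cid; apply: refine_fun => // w w'; exact: VV.
pose h t := projT1 (hE t).
have hV t w : h t (V w) = Vt t w by rewrite (projT2 (hE t)).
pose k1 t b a := law p (fun w => (U w t, Vt t w)) (a, h t b) / law p (Vt t) (h t b).
pose k b (a : {ffun 'I_n -> A}) := \prod_t k1 t b (a t).
have L0 t : forall ad, 0 <= law p (fun w => (U w t, Vt t w)) ad by exact: law_ge0.
have L0' t : forall d, 0 <= law p (Vt t) d by exact: law_ge0.
have lgt t w : 0 < p w -> 0 < law p (fun w => (U w t, Vt t w)) (U w t, Vt t w).
  exact: (law_gt0 p_ge0 (fun w => (U w t, Vt t w))).
have -> : \sum_t cent p (fun w => U w t) (Vt t) = - \sum_w p w * log2 (k (V w) (U w)).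
  transitivity (\sum_t - \sum_w p w *
     (log2 (law p (fun w => (U w t, Vt t w)) (U w t, Vt t w)) -
     log2 (law p (Vt t) (Vt t w)))).
    apply: eq_bigr => t _; rewrite /cent /ent -opprD -sumrN -big_split /=.
    by congr (- _); apply: eq_bigr => w _; rewrite -mulrN -mulrDr.
  rewrite sumrN exchange_big /=; congr (- _); apply: eq_bigr => w _.
  have := p_ge0 w; rewrite le_eqVlt => /predU1P [<-|pw].
    by rewrite !mul0r big1 // => t _; rewrite mul0r.
  rewrite -mulr_sumr log2_prod => [|t _]; last by rewrite /k1 hV divr_gt0 ?law_gt0 ?lgt.
  by congr (_ * _); apply: eq_bigr => t _; rewrite /k1 hV log2_div ?law_gt0 ?lgt.
apply: gibbs => [b a|b|w pw].
- by apply: prodr_ge0 => t _; rewrite divr_ge0.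
- rewrite /k -(bigA_distr_bigA (fun t a => k1 t b a)) /k1 /=.
  apply: prodr_ile1 => t _; rewrite sumr_ge0 ?andbT /= => [|a _]; last by rewrite divr_ge0.
  rewrite -mulr_suml law_marg; have [->|n0] := eqVneq (law p (Vt t) (h t b)) 0.
    by rewrite mul0r.
  by rewrite divff.
- by apply: prodr_gt0 => t _; rewrite /k1 hV divr_gt0 ?law_gt0 ?lgt.
Qed.

End Inequalities.
End Entropy.

(** * Fano's inequality and the genie bound *)

Section Probability.
Variables (R : realType) (W : finType) (p : W -> R).
Hypothesis pmf_p : is_pmf p.

Let p_ge0 : forall w, 0 <= p w. Proof. by case: pmf_p. Qed.
Let p_sum1 : \sum_w p w = 1. Proof. by case: pmf_p. Qed.

Lemma pmf_card_gt0 : (0 < #|W|)%N.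
Proof.
rewrite lt0n; apply/eqP => /card0_eq W0.
have := p_sum1; rewrite big_pred0 // => /esym/eqP.
by rewrite oner_eq0.
Qed.

Lemma is_pmf_law (A : finType) (U : W -> A) : is_pmf (law p U).
Proof. by split=> [a|]; [exact: law_ge0 | rewrite law_total]. Qed.

Lemma ent_const (A : finType) (a : A) : ent p (fun=> a) = 0.
Proof.
rewrite /ent big1 ?oppr0 // => w _.
rewrite /law (eq_bigl xpredT) => [|w']; last by rewrite eqxx.
by rewrite p_sum1 log2_1 mulr0.
Qed.

Lemma cent_const (A B : finType) (a : A) (V : W -> B) : cent p (fun=> a) V = 0.
Proof.
apply/eqP; rewrite subr_eq0; apply/eqP/ent_equiv => w w'.
by rewrite xpair_eqE eqxx.
Qed.

Lemma cent_tt (A : finType) (U : W -> A) : cent p U (fun=> tt) = ent p U.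
Proof.
rewrite /cent ent_const subr0.
by apply: ent_equiv => w w'; rewrite xpair_eqE eqxx andbT.
Qed.

Lemma cent_le_ent (A B : finType) (U : W -> A) (V : W -> B) :
  cent p U V <= ent p U.
Proof. by rewrite -cent_tt; apply: cent_coarsen => //; exact: pmf_card_gt0. Qed.

Lemma card_pmf_gt0 (A : finType) (U : W -> A) : (0 < #|A|)%N.
Proof.
have /card_gt0P [w _] := pmf_card_gt0.
by apply/card_gt0P; exists (U w).
Qed.

Lemma ent_le_card (A : finType) (U : W -> A) : ent p U <= log2 #|A|%:R.
Proof.
have A0 : 0 < #|A|%:R :> R by rewrite ltr0n card_pmf_gt0.
have A0' : 0 < #|A|%:R^-1 :> R by rewrite invr_gt0.
rewrite -cent_tt.
apply: le_trans (gibbs p_ge0 (k := fun=> fun=> #|A|%:R^-1) _ _ _) _ => //.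
  by move=> _; rewrite sumr_const -[leLHS]mulr_natr mulVf // gt_eqF.
by rewrite -mulr_suml p_sum1 mul1r log2V // opprK.
Qed.

Lemma ent_uniform (A : finType) (U : W -> A) :
  (forall a, law p U a = #|A|%:R^-1) -> ent p U = log2 #|A|%:R.
Proof.
move=> lawU; rewrite /ent; under eq_bigr do rewrite lawU.
rewrite -mulr_suml p_sum1 mul1r log2V ?opprK // ltr0n.
exact: card_pmf_gt0.
Qed.

(* Gibbs' inequality with the kernel that guesses [d V] with probability 1/2
   and is uniform otherwise. *)
Lemma fano (A B : finType) (U : W -> A) (V : W -> B) (d : B -> A) :
  cent p U V <= 1 + (\sum_(w | d (V w) != U w) p w) * log2 #|A|%:R.
Proof.
have cA := card_pmf_gt0 U.
have A0 : 0 < #|A|%:R :> R by rewrite ltr0n.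
have A1 : 1 <= #|A|%:R :> R by rewrite ler1n.
have A0' : 0 < #|A|%:R^-1 :> R by rewrite invr_gt0.
pose k b a : R := 2^-1 * ((d b == a)%:R + #|A|%:R^-1).
have k0 b a : 0 < k b a by rewrite mulr_gt0 ?invr_gt0 // ltr_wpDl.
apply: le_trans (gibbs p_ge0 (k := k) _ _ _) _ => //.
- by move=> b a; exact: ltW.
- move=> b; rewrite -mulr_sumr big_split /= sumr_const -[_^-1 *+ _]mulr_natr mulVf ?gt_eqF //.
  rewrite (bigD1 (d b)) //= eqxx big1 ?addr0 => [|a]; first by rewrite /=; lra.
  by rewrite eq_sym => /negPf ->.
rewrite lerNl opprD -{1}p_sum1 -sumrN mulr_suml -sumrN [in X in _ + X]big_mkcond -big_split /=.
apply: ler_sum => w _.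
have -> : - p w + (if d (V w) != U w then - (p w * log2 #|A|%:R) else 0) =
  p w * (- 1 + (if d (V w) != U w then - log2 #|A|%:R else 0)).
  by case: ifP => _; ring.
rewrite ler_wpM2l // /k log2M ?invr_gt0 //; last by rewrite ltr_wpDl.
(* The factor 1/2 of the kernel costs the one bit of the bound. The remaining factor is at least 1
   where the guess is right and equals 1/#|A| elsewhere. *)
rewrite log2V // log2_2 lerD2l; case: eqP => /= _.
  by rewrite log2_ge0 // lerDl ltW.
by rewrite add0r log2V.
Qed.

(* [G] is the genie's message, [C] the interfering codeword that may be
   revealed, and [M2] the part of [M] revealed for a given subset of
   transmitters; given [M], the output [Y] is equivalent to [S]. *)
Lemma genie_bound (A1 A2 A3 A4 A5 A6 : finType) (M : W -> A1) (Y : W -> A2)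
    (S : W -> A3) (G : W -> A4) (M2 : W -> A5) (C : W -> A6) :
  (forall w w', M w = M w' -> M2 w = M2 w') ->
  (forall w w', M w = M w' -> (Y w == Y w') = (S w == S w')) ->
  cent p M (fun w => (M2 w, C w)) <=
  cent p M Y + (ent p G - cent p G (fun w => (M w, C w))) +
  cent p Y (fun w => (G w, M2 w, C w)) - cent p S (fun w => (G w, M w, C w)).
Proof.
move=> MM2 MYS; have W0 := pmf_card_gt0.
(* [h1] and [h2] are the only inequalities. The rest is an identity between joint entropies, once
   tuples with the same fibres are identified. *)
have h1 : cent p M (fun w => (Y w, (G w, M2 w, C w))) <= cent p M Y.
  by apply: cent_coarsen => // w w' [].
have h2 := cent_le_ent G (fun w => (M2 w, C w)).
have e1 : ent p (fun w => (M w, (M2 w, C w))) = ent p (fun w => (M w, C w)).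
  apply: ent_equiv => w w'; rewrite !xpair_eqE.
  by case: (M w =P M w') => //= /MM2 ->; rewrite eqxx.
(* Invertibility of the channel map enters here: next to M, the output may be exchanged for the
   interference. *)
have e3 : ent p (fun w => (M w, (Y w, (G w, M2 w, C w)))) =
    ent p (fun w => (S w, (G w, M w, C w))).
  apply: ent_equiv => w w'; rewrite !xpair_eqE.
  case: (M w =P M w') => [e|] /=; last by rewrite andbF andFb andbF.
  by rewrite (MM2 _ _ e) (MYS _ _ e) eqxx !andbT.
have e5 : ent p (fun w => (G w, (M w, C w))) = ent p (fun w => (G w, M w, C w)).
  by apply: ent_equiv => w w'; rewrite !xpair_eqE andbA.
have e6 : ent p (fun w => (G w, (M2 w, C w))) = ent p (fun w => (G w, M2 w, C w)).
  by apply: ent_equiv => w w'; rewrite !xpair_eqE andbA.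
move: h1 h2; rewrite /cent e1 e3 e5 e6; lra.
Qed.

End Probability.

(** * Independent components *)

Section ProductSpace.
Variables (R : realType) (I : finType) (T : I -> finType).
Variable p : forall i, T i -> R.
Hypothesis pmf_p : forall i, is_pmf (@p i).

Definition prod_pmf (w : {dffun forall i, T i}) : R := \prod_i @p i (w i).

Lemma is_pmf_prod : is_pmf prod_pmf.
Proof.
split=> [w|]; first by apply: prodr_ge0 => i _; case: (pmf_p i).
rewrite /prod_pmf sum_dffun_prod big1 // => i _.
by case: (pmf_p i).
Qed.

Lemma law_prod_map (A : I -> finType) (f : forall i, T i -> A i) a :
  law prod_pmf (fun w => [ffun i => f i (w i)] : {dffun forall i, A i}) a =
  \prod_i law (@p i) (@f i) (a i).
Proof.
rewrite /law -(sum_dffun_prod_cond (fun i x => f i x == a i)).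
apply: eq_bigl => w; apply/eqP/forallP => [<- i|fa]; first by rewrite ffunE.
by apply/ffunP => i; rewrite ffunE; apply/eqP.
Qed.

End ProductSpace.

Section TwoCells.
Variables (R : realType) (T : bool -> finType).
Variable p : forall i, T i -> R.
Hypothesis pmf_p : forall i, is_pmf (@p i).

Let p_sum1 i : \sum_x @p i x = 1. Proof. by case: (pmf_p i). Qed.

Lemma law_cells i (A B : finType) (U : T i -> A) (V : T (~~ i) -> B) a b :
  law (prod_pmf p) (fun w => (U (w i), V (w (~~ i)))) (a, b) =
  law (@p i) U a * law (@p (~~ i)) V b.
Proof.
case: i U V => U V /=.
- pose P k := match k return pred (T k) with
    | true => fun x => U x == a | false => fun x => V x == b end.
  have := sum_dffun_prod_cond P p; rewrite big_bool /= => <-.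
  apply: eq_bigl => w; rewrite xpair_eqE.
  by apply/andP/forallP => [[? ?] []|h] //; split; [apply: (h true)|apply: (h false)].
- pose P k := match k return pred (T k) with
    | false => fun x => U x == a | true => fun x => V x == b end.
  have := sum_dffun_prod_cond P p; rewrite big_bool /= mulrC => <-.
  apply: eq_bigl => w; rewrite xpair_eqE.
  by apply/andP/forallP => [[? ?] []|h] //; split; [apply: (h false)|apply: (h true)].
Qed.

Lemma law_cell i (A : finType) (U : T i -> A) :
  law (prod_pmf p) (fun w => U (w i)) =1 law (@p i) U.
Proof.
move=> a; have := law_cells U (fun=> tt) a tt.
rewrite [X in _ * X](_ : _ = 1); last first.
  by rewrite -[RHS](p_sum1 (~~ i)); apply: eq_bigl => x; rewrite eqxx.
rewrite mulr1 => <-; apply: eq_bigl => w.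
by rewrite xpair_eqE eqxx andbT.
Qed.

Lemma ent_cell i (A : finType) (U : T i -> A) :
  ent (prod_pmf p) (fun w => U (w i)) = ent (@p i) U.
Proof.
by rewrite !entE; congr (- _); apply: eq_bigr => a _; rewrite law_cell.
Qed.

Lemma ent_cells i (A B : finType) (U : T i -> A) (V : T (~~ i) -> B) :
  ent (prod_pmf p) (fun w => (U (w i), V (w (~~ i)))) =
  ent (@p i) U + ent (@p (~~ i)) V.
Proof.
rewrite -ent_cell -(ent_cell V) /ent -opprD -big_split /=; congr (- _).
apply: eq_bigr => w _; rewrite -mulrDr.
have [p0 _] := is_pmf_prod pmf_p.
have := p0 w; rewrite le_eqVlt => /predU1P [<-|pw]; first by rewrite !mul0r.
by rewrite law_cells -!law_cell log2M // (law_gt0 p0 _ pw).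
Qed.

End TwoCells.

Section Rates.
Variable R : realType.

Lemma powR2_ge1 (n : nat) (rho : R) : 0 <= rho -> 1 <= 2 `^ (n%:R * rho) :> R.
Proof.
move=> r0; rewrite -[leLHS](powRr0 2) ler_powR ?ler1n // mulr_ge0 //.
Qed.

Lemma nmsg_gt0 (n : nat) (rho : R) : 0 <= rho -> (0 < nmsg n rho)%N.
Proof. by move=> r0; rewrite truncn_gt0 powR2_ge1. Qed.

Lemma log2_2powR (x : R) : log2 (2 `^ x) = x.
Proof. by rewrite /log2 ln_powR mulfK // gt_eqF // ln2_gt0. Qed.

(** Rounding costs at most one bit: with m the number of messages, 2^{n rho} < m + 1 <= 2 m since m
    >= 1. *)
Lemma log2_nmsg (n : nat) (rho : R) : 0 <= rho ->
  n%:R * rho - 1 <= log2 (nmsg n rho)%:R <= n%:R * rho.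
Proof.
move=> r0; have x1 := powR2_ge1 n r0; set x := 2 `^ _ in x1.
have m0 := nmsg_gt0 n r0; have m0' : 0 < (nmsg n rho)%:R :> R by rewrite ltr0n.
have x0 : 0 < x by rewrite (lt_le_trans _ x1).
have lx : log2 x = n%:R * rho by rewrite log2_2powR.
apply/andP; split; last first.
  by rewrite -lx ler_log2 // truncn_le // ltW.
rewrite lerBlDr -[X in _ <= _ + X]log2_2 -log2M // -lx ler_log2 //.
have m1 : 1 <= (nmsg n rho)%:R :> R by rewrite ler1n.
have := truncnS_gt x; rewrite -/(nmsg n rho) -natr1; lra.
Qed.

End Rates.

(** * Block codes *)

Section SingleLetter.
Variables (R : realType) (C : sdmac R).

(* Values ((t_1, t_2), (x_{Theta_1}, x_{Theta_2}), (s_1, s_2)). *)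
Definition letter : finType := (svec C * input C * svec C)%type.

Definition input_laws : Type := forall i (j : 'I_(ntx C i)), inA j -> R.

Definition letter_law (px : input_laws) (w : letter) : R :=
  \prod_(i : bool) (pS (w.1.2 i (tx1 C i)) (w.1.1 i) *
    \prod_(j < ntx C i) px i j (w.1.2 i j)) * pSS w.1.2 w.2.

Definition lT (i : bool) (w : letter) : sA C i := w.1.1 i.
Definition lX (i : bool) (j : 'I_(ntx C i)) (w : letter) : inA j := w.1.2 i j.
Definition lS (i : bool) (w : letter) : sA C i := w.2 i.
Definition lY (i : bool) (w : letter) : outA C i := output w.1.2 w.2 i.

Definition lXS (i : bool) (D : {set 'I_(ntx C i)}) (w : letter)
    : {dffun forall j : {j : 'I_(ntx C i) | j \in D}, inA (val j)} :=
  [ffun j : {j : 'I_(ntx C i) | j \in D} => lX (val j) w].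

(** A withheld component becomes the constant [None], so the four bounds share one type of
    conditioning variable and one proof. *)
Definition opt (b : bool) (A : Type) (a : A) : option A :=
  if b then Some a else None.

(* The four bounds at a single time: [a] tells whether T_i is given and [b]
   whether X_{i'.1} is, so that A, B, E, G are the cases (true, true),
   (false, true), (true, false), (false, false). *)
Definition lcond (a b : bool) i (D : {set 'I_(ntx C i)}) (w : letter) :=
  (opt a (lT i w), lXS (~: D) w, opt b (lX (tx1 C (~~ i)) w)).

Definition letter_bound (px : input_laws) (a b : bool) i
    (D : {set 'I_(ntx C i)}) : R :=
  cent (letter_law px) (lY i) (lcond a b D) -
  cent (letter_law px) (lS (~~ i)) (lX (tx1 C (~~ i))).

End SingleLetter.

Section Block.
Variables (R : realType) (C : sdmac R) (n : nat) (r : rates C).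
Hypothesis r_ge0 : rate_nneg r.
Variable c : code n r.

Definition cmsgs (i : bool) : finType :=
  {dffun forall j : 'I_(ntx C i), msg n r j}.

(* Messages of a cell, S_i^n and the genie's T_i^n. *)
Definition cell (i : bool) : finType :=
  (cmsgs i * {ffun 'I_n -> sA C i} * {ffun 'I_n -> sA C i})%type.

Definition cX i (m : cmsgs i) (t : 'I_n) : cell_input C i :=
  [ffun j : 'I_(ntx C i) => enc c (m j) t].

Definition ker_S i (m : cmsgs i) (s : {ffun 'I_n -> sA C i}) : R :=
  \prod_(t < n) pS (cX m t (tx1 C i)) (s t).

Definition cell_pmf i (w : cell i) : R :=
  #|cmsgs i|%:R^-1 * ker_S w.1.1 w.1.2 * ker_S w.1.1 w.2.

Definition cM i (w : cell i) : cmsgs i := w.1.1.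
Definition cS i (w : cell i) : {ffun 'I_n -> sA C i} := w.1.2.
Definition cT i (w : cell i) : {ffun 'I_n -> sA C i} := w.2.

Lemma msg_gt0 i (j : 'I_(ntx C i)) : (0 < #|msg n r j|)%N.
Proof. by rewrite card_ord nmsg_gt0. Qed.

Lemma card_cmsgs_gt0 i : 0 < #|cmsgs i|%:R :> R.
Proof.
by rewrite card_dffunR prodr_gt0 // => j _; rewrite ltr0n msg_gt0.
Qed.

Lemma pS_ge0 i x s : 0 <= @pS _ C i x s.
Proof. by case: (pS_pmf x). Qed.

Lemma sum_pS i x : \sum_s @pS _ C i x s = 1.
Proof. by case: (pS_pmf x). Qed.

Lemma ker_S_ge0 i (m : cmsgs i) s : 0 <= ker_S m s.
Proof. by apply: prodr_ge0 => t _; exact: pS_ge0. Qed.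

Lemma sum_ker_S i (m : cmsgs i) : \sum_s ker_S m s = 1.
Proof.
rewrite -(bigA_distr_bigA (fun t s => pS (cX m t (tx1 C i)) s)) /=.
by rewrite big1 // => t _; rewrite sum_pS.
Qed.

Lemma sum_ker_S_at i (m : cmsgs i) (t : 'I_n) a :
  \sum_(s : {ffun 'I_n -> sA C i} | s t == a) ker_S m s =
  pS (cX m t (tx1 C i)) a.
Proof.
pose P (u : 'I_n) : pred (sA C i) := fun x => (u == t) ==> (x == a).
have := @bigA_distr_big_dep R 0 1 *%R +%R _ _ P (fun u x => pS (cX m u (tx1 C i)) x).
rewrite (bigD1 t) //= [X in _ * X = _]big1 => [|u ut]; last first.
  by rewrite -(sum_pS (cX m u (tx1 C i))); apply: eq_bigl => x; rewrite /P (negPf ut).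
rewrite mulr1 (big_pred1 a) => [->|x]; last by rewrite /P eqxx.
apply: eq_bigl => s; apply/eqP/familyP => [sa u|/(_ t)]; rewrite /P unfold_in.
  by apply/implyP => /eqP ->; rewrite sa.
by rewrite eqxx => /eqP.
Qed.

(** The marginals of a cell used below are read off from this formula by choosing the three
    predicates. *)
Lemma sum_cell i (P1 : pred (cmsgs i)) (P2 P3 : pred {ffun 'I_n -> sA C i}) :
  \sum_(w : cell i | P1 (cM w) && P2 (cS w) && P3 (cT w)) cell_pmf w =
  \sum_(m | P1 m) #|cmsgs i|%:R^-1 * (\sum_(s | P2 s) ker_S m s) *
    (\sum_(t | P3 t) ker_S m t).
Proof.
rewrite -(pair_big (fun x : cmsgs i * {ffun 'I_n -> sA C i} => P1 x.1 && P2 x.2) P3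
   (fun x t => #|cmsgs i|%:R^-1 * ker_S x.1 x.2 * ker_S x.1 t)) /=.
rewrite -(pair_big P1 P2
   (fun m s => \sum_(t | P3 t) #|cmsgs i|%:R^-1 * ker_S m s * ker_S m t)) /=.
apply: eq_bigr => m _; rewrite -mulrA mulr_suml mulr_sumr; apply: eq_bigr => s _.
by rewrite mulrA mulr_sumr.
Qed.

Lemma is_pmf_cell i : is_pmf (@cell_pmf i).
Proof.
split=> [w|].
  by rewrite /cell_pmf !mulr_ge0 ?ker_S_ge0 // invr_ge0 ltW // card_cmsgs_gt0.
rewrite (sum_cell xpredT xpredT xpredT).
under eq_bigr do rewrite !sum_ker_S !mulr1.
by rewrite sumr_const -[LHS]mulr_natr mulVf // gt_eqF // card_cmsgs_gt0.
Qed.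

Lemma law_cSM i s m :
  law (@cell_pmf i) (fun w => (cS w, cM w)) (s, m) = #|cmsgs i|%:R^-1 * ker_S m s.
Proof.
have := sum_cell (pred1 m) (pred1 s) xpredT.
rewrite !big_pred1_eq sum_ker_S mulr1 => <-; apply: eq_bigl => w.
by rewrite xpair_eqE andbT andbC.
Qed.

Lemma law_cTM i t m :
  law (@cell_pmf i) (fun w => (cT w, cM w)) (t, m) = #|cmsgs i|%:R^-1 * ker_S m t.
Proof.
have := sum_cell (pred1 m) xpredT (pred1 t).
rewrite !big_pred1_eq sum_ker_S mulr1 => <-; apply: eq_bigl => w.
by rewrite xpair_eqE andbT andbC.
Qed.

Lemma law_cM i m : law (@cell_pmf i) (@cM i) m = #|cmsgs i|%:R^-1.
Proof.
rewrite -(law_marg _ (@cS i)); under eq_bigr do rewrite law_cSM.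
by rewrite -mulr_sumr sum_ker_S mulr1.
Qed.

Lemma ent_cT i : ent (@cell_pmf i) (@cT i) = ent (@cell_pmf i) (@cS i).
Proof.
rewrite -[LHS](ent_law (@cell_pmf i) (fun w => (cT w, cM w)) fst).
rewrite -[RHS](ent_law (@cell_pmf i) (fun w => (cS w, cM w)) fst).
by apply: eq_ent_law => -[s m]; rewrite law_cTM law_cSM.
Qed.

Lemma cent_cTM i : cent (@cell_pmf i) (@cT i) (@cM i) =
  cent (@cell_pmf i) (@cS i) (@cM i).
Proof.
rewrite -[LHS](cent_law (@cell_pmf i) (fun w => (cT w, cM w)) fst snd).
rewrite -[RHS](cent_law (@cell_pmf i) (fun w => (cS w, cM w)) fst snd).
by apply: eq_cent_law => -[s m]; rewrite law_cTM law_cSM.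
Qed.

Definition letter_S i : R :=
  \sum_t cent (@cell_pmf i) (fun w => cS w t) (fun w => cX (cM w) t (tx1 C i)).

(** The conditional law of S^n given M is [ker_S], so H(S^n | M) is exactly minus the mean of its
    logarithm. This splits over time into cross-entropies with respect to the channel, each at least
    H(S_t | X_t) by Gibbs. Both the cost of the genie and the interference term call for this
    direction. *)
Lemma cent_cSM i : letter_S i <= cent (@cell_pmf i) (@cS i) (@cM i).
Proof.
have [p0 _] := is_pmf_cell i; have M0 := card_cmsgs_gt0 i.
have M0' : 0 < #|cmsgs i|%:R^-1 :> R by rewrite invr_gt0.
have pk (w : cell i) : 0 < cell_pmf w -> forall t, 0 < pS (cX (cM w) t (tx1 C i)) (cS w t).
  move=> pw t; rewrite lt_neqAle pS_ge0 andbT eq_sym; apply/eqP => k0.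
  by move: pw; rewrite /cell_pmf /ker_S (bigD1 t) //= k0 mul0r mulr0 mul0r ltxx.
have -> : cent (@cell_pmf i) (@cS i) (@cM i) =
    - \sum_(w : cell i) cell_pmf w * log2 (ker_S (cM w) (cS w)).
  rewrite /cent /ent -opprD -sumrN -big_split /=; congr (- _).
  apply: eq_bigr => w _; rewrite law_cSM law_cM -mulrN -mulrDr.
  have := p0 w; rewrite le_eqVlt => /predU1P [<-|pw]; first by rewrite !mul0r.
  have kw : 0 < ker_S (cM w) (cS w) by apply: prodr_gt0 => t _; exact: pk.
  by rewrite (log2M M0' kw) [log2 _ + _]addrC addrK.
rewrite (_ : - _ = \sum_t - \sum_(w : cell i) cell_pmf w *
    log2 (pS (cX (cM w) t (tx1 C i)) (cS w t))).
  apply: ler_sum => t _; apply: (gibbs p0) => [x s|x|w pw].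
  - exact: pS_ge0.
  - by rewrite sum_pS.
  - exact: pk.
rewrite sumrN exchange_big /=; congr (- _); apply: eq_bigr => w _.
have := p0 w; rewrite le_eqVlt => /predU1P [<-|pw].
  by rewrite !mul0r big1 // => t _; rewrite mul0r.
by rewrite -mulr_sumr log2_prod // => t _; exact: pk.
Qed.

Lemma ent_cM i : ent (@cell_pmf i) (@cM i) = \sum_(j < ntx C i) log2 #|msg n r j|%:R.
Proof.
rewrite (ent_uniform (is_pmf_cell i)) => [|m]; last exact: law_cM.
by rewrite card_dffunR log2_prod // => j _; rewrite ltr0n msg_gt0.
Qed.

Definition cMS i (D : {set 'I_(ntx C i)}) (m : cmsgs i)
    : {dffun forall j : {j : 'I_(ntx C i) | j \in D}, msg n r (val j)} :=
  [ffun j : {j : 'I_(ntx C i) | j \in D} => m (val j)].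

Lemma ent_cMS i (D : {set 'I_(ntx C i)}) :
  ent (@cell_pmf i) (fun w => cMS D (cM w)) <= \sum_(j in D) log2 #|msg n r j|%:R.
Proof.
apply: le_trans (ent_le_card (is_pmf_cell i) _) _.
rewrite card_dffunR log2_prod => [|j _]; last by rewrite ltr0n msg_gt0.
by rewrite [leRHS]big_sub.
Qed.

Definition block_pmf : {dffun forall i, cell i} -> R := prod_pmf cell_pmf.

Lemma is_pmf_block : is_pmf block_pmf.
Proof. by apply: is_pmf_prod => i; exact: is_pmf_cell. Qed.

Definition bM i (w : {dffun forall i, cell i}) : cmsgs i := cM (w i).
Definition bY i (w : {dffun forall i, cell i}) : {ffun 'I_n -> outA C i} :=
  [ffun t => phi (cX (bM i w) t) (cS (w (~~ i)) t)].

Definition bdec i (y : {ffun 'I_n -> outA C i}) : cmsgs i :=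
  [ffun j : 'I_(ntx C i) => dec c y j].

(** The block space is a product over cells and carries the genie's vectors, whereas [error_prob]
    sums over messages and a product over time. The map [psi] forgets the genie and regroups by
    time, and its law is the one in [error_prob]. *)
Lemma block_error i :
  \sum_(w | bdec (bY i w) != bM i w) block_pmf w <= error_prob c.
Proof.
have [p0 _] := is_pmf_block.
pose f k (w : cell k) := (cM w, cS w).
pose psi (w : {dffun forall i, cell i}) : msgs n r * {ffun 'I_n -> svec C} :=
  ([ffun k => bM k w], [ffun t => [ffun k => cS (w k) t]]).
have law_psi ms : law block_pmf psi ms =
    #|msgs n r|%:R^-1 * \prod_(t < n) pSS (sent c ms.1 t) (ms.2 t).
  case: ms => m s /=.
  (* The same data regrouped by cell, where the law is a product; [exchange_big] then swaps cells
     and times. *)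
  pose a := [ffun k => (m k, [ffun t => s t k])] :
     {dffun forall k, (cmsgs k * {ffun 'I_n -> sA C k})%type}.
  transitivity (law block_pmf (fun w => [ffun k => f k (w k)]
     : {dffun forall k, (cmsgs k * {ffun 'I_n -> sA C k})%type}) a).
    apply: eq_bigl => w; apply/eqP/eqP => [[em es]|/ffunP E].
      apply/ffunP => k; rewrite !ffunE -em -es; congr (_, _); first by rewrite ffunE.
      by apply/ffunP => t; rewrite !ffunE.
    congr (_, _); first by apply/ffunP => k; have := E k; rewrite !ffunE => -[].
    apply/ffunP => t; rewrite ffunE; apply/ffunP => k; have := E k.
    rewrite !ffunE => -[_ /ffunP/(_ t)].
    by rewrite !ffunE.
  rewrite law_prod_map card_dffunR -prodfV /pSS exchange_big -big_split /=.
  apply: eq_bigr => k _; rewrite ffunE /f.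
  rewrite -[LHS](law_comp _ (fun w => (cS w, cM w)) (fun x => (x.2, x.1))).
  rewrite /law (big_pred1 ([ffun t => s t k], m k)) => [|[s' m'] /=]; last first.
    by rewrite !xpair_eqE andbC.
  rewrite -/(law _ _ _) law_cSM; congr (_ * _); apply: eq_bigr => t _.
  by rewrite !ffunE.
rewrite /error_prob mulr_sumr.
under [leRHS]eq_bigr do rewrite mulr_sumr.
rewrite (pair_big_dep xpredT (fun m s => wrong c m s) (fun m s =>
  #|msgs n r|%:R^-1 * \prod_(t < n) pSS (sent c m t) (s t))) /=.
under [leRHS]eq_bigr do rewrite -law_psi.
have -> : \sum_(ms | wrong c ms.1 ms.2) law block_pmf psi ms =
    \sum_w block_pmf w * (wrong c (psi w).1 (psi w).2)%:R.
  rewrite -(sum_law block_pmf psi (fun ms => (wrong c ms.1 ms.2)%:R)) big_mkcond.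
  by apply: eq_bigr => ms _; case: ifP; rewrite ?mulr1 ?mulr0.
rewrite big_mkcond; apply: ler_sum => w _.
case: ifPn => [bad|_]; last by rewrite mulr_ge0.
suff -> : wrong c (psi w).1 (psi w).2 by rewrite mulr1.
apply/existsP; exists i; apply/existsP.
move: bad; apply: contraNP => /forallNP good; apply/eqP/ffunP => j.
move: (good j) => /negP; rewrite negbK !ffunE => /eqP <-; congr (dec c _ j).
apply/ffunP => t; rewrite !ffunE /output; congr (phi _ _); last by rewrite !ffunE.
by rewrite !ffunE; apply/ffunP => j'; rewrite !ffunE.
Qed.

End Block.

(** * The n-letter converse *)

Section BlockBound.
Variables (R : realType) (C : sdmac R) (n : nat) (r : rates C).
Hypothesis r_ge0 : rate_nneg r.
Variable c : code n r.

Notation W := {dffun forall i, cell n r i}.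
Notation pW := (block_pmf c).

Lemma cent_cell_same i (A B : finType) (U : cell n r i -> A) (V : cell n r i -> B) :
  cent pW (fun w => U (w i)) (fun w => V (w i)) = cent (cell_pmf c (i:=i)) U V.
Proof.
have pp := is_pmf_cell r_ge0 c.
by rewrite /cent -(ent_cell pp V) -(ent_cell pp (fun w => (U w, V w))).
Qed.

Definition bletter (t : 'I_n) (w : W) : letter C :=
  ([ffun i => cT (w i) t], [ffun i => cX c (cM (w i)) t], [ffun i => cS (w i) t]).

Definition block_px (t : 'I_n) : input_laws C := fun i j =>
  law (fun=> #|msg n r j|%:R^-1) (fun m => enc c m t).

Lemma is_pmf_block_px t i (j : 'I_(ntx C i)) : is_pmf (@block_px t i j).
Proof.
apply: is_pmf_law; split=> [m|]; first by rewrite invr_ge0.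
rewrite sumr_const -[LHS]mulr_natr mulVf // pnatr_eq0 -lt0n.
exact: msg_gt0.
Qed.

Lemma sum_cX t i (x : cell_input C i) :
  \sum_(m | cX c m t == x) #|cmsgs n r i|%:R^-1 =
  \prod_(j < ntx C i) block_px t (x j).
Proof.
rewrite /block_px -(law_prod_map _ (fun j (m : msg n r j) => enc c m t)).
rewrite /law /prod_pmf; apply: eq_big => [m|m _]; first by [].
by rewrite card_dffunR prodfV.
Qed.

(** At a fixed time the letters have the product form demanded of P_o given Q, since encoders use
    independent messages and the channels are memoryless. This makes the time index an admissible
    Q. *)
Lemma law_bletter t : law pW (bletter t) =1 letter_law (block_px t).
Proof.
case=> [[tt x] s].
pose f i (w : cell n r i) := (cT w t, cX c (cM w) t, cS w t).
pose A i : finType := (sA C i * cell_input C i * sA C i)%type.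
pose a := [ffun k => (tt k, x k, s k)] : {dffun forall k, A k}.
transitivity (law pW (fun w => [ffun k => f k (w k)] : {dffun forall k, A k}) a).
  apply: eq_bigl => w; apply/eqP/eqP => [[et ex es]|/ffunP E].
    by apply/ffunP => k; rewrite !ffunE -et -ex -es !ffunE.
  by congr (_, _, _); apply/ffunP => k; have := E k; rewrite !ffunE => -[].
rewrite law_prod_map /letter_law /pSS -big_split /=; apply: eq_bigr => k _.
rewrite ffunE /f -sum_cX mulr_sumr mulr_suml.
transitivity (\sum_(w : cell n r k | (cX c (cM w) t == x k) && (cS w t == s k) &&
    (cT w t == tt k)) cell_pmf c w).
  by apply: eq_bigl => w; rewrite !xpair_eqE -andbA andbC.
rewrite (sum_cell c (fun m => cX c m t == x k) (fun u => u t == s k) (fun u => u t == tt k)).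
apply: eq_bigr => m /eqP <-; rewrite !sum_ker_S_at.
ring.
Qed.

Definition excess i : R := ent (cell_pmf c (i:=i)) (@cS _ _ _ _ i) - letter_S c i.

(** In the last bracket, [ntx C i] pays for rounding the numbers of messages, at most one bit per
    transmitter, and the rest is Fano's inequality for all messages of the cell. *)
Lemma block_bound (a b : bool) i (D : {set 'I_(ntx C i)}) :
  n%:R * rsum r D <= \sum_t letter_bound (block_px t) a b D
    + (if a then excess i else 0) - (if b then 0 else excess (~~ i))
    + ((ntx C i)%:R + 1 + error_prob c * (n%:R * rsum r [set: 'I_(ntx C i)]%SET)).
Proof.
have pp := is_pmf_cell r_ge0 c; have [p0 _] := is_pmf_block r_ge0 c.
have W0 := pmf_card_gt0 (is_pmf_block r_ge0 c).
pose M (w : W) := cM (w i).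
pose M2 (w : W) := cMS (~: D) (cM (w i)).
pose G (w : W) := opt a (cT (w i)).
(* The genie reveals the message behind X_{i'.1}^n, which determines the codeword and is independent
   of cell i. *)
pose X (w : W) := opt b (cM (w (~~ i)) (tx1 C (~~ i))).
pose S (w : W) := cS (w (~~ i)).
have := @genie_bound _ _ _ (is_pmf_block r_ge0 c) _ _ _ _ _ _
  M (bY c i) S G M2 X.
have MM2 w w' : M w = M w' -> M2 w = M2 w' by rewrite /M2 /M => ->.
have MYS w w' : M w = M w' -> (bY c i w == bY c i w') = (S w == S w').
  rewrite /M => e; apply/eqP/eqP => /ffunP h; apply/ffunP => t.
    by have := h t; rewrite !ffunE /bM e => /phi_inj.
  by rewrite !ffunE /bM e; congr (phi _ _); exact: h.
move=> /(_ MM2 MYS).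
have hM : rsum r D * n%:R - (ntx C i)%:R <= cent pW M (fun w => (M2 w, X w)).
  have -> : cent pW M (fun w => (M2 w, X w)) =
      ent (cell_pmf c (i:=i)) (@cM _ _ _ _ i) -
      ent (cell_pmf c (i:=i)) (fun w => cMS (~: D) (cM w)).
    rewrite /cent (ent_cells pp (fun w => cMS (~: D) (cM w))
      (fun w => opt b (cM w (tx1 C (~~ i))))).
    rewrite (_ : ent pW _ = ent pW (fun w => (M w, X w))); last first.
      apply: ent_equiv => w w'; rewrite !xpair_eqE.
      by case: (M w =P M w') => //= /MM2 ->; rewrite eqxx.
    rewrite (ent_cells pp (@cM _ _ _ _ i) (fun w => opt b (cM w (tx1 C (~~ i))))).
    by rewrite opprD addrACA subrr addr0.
  have le1 : ent (cell_pmf c (i:=i)) (fun w => cMS (~: D) (cM w)) <=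
      \sum_(j | j \notin D) log2 #|msg n r j|%:R.
    apply: le_trans (ent_cMS r_ge0 c (~: D)) _.
    by rewrite le_eqVlt; apply/orP; left; apply/eqP/eq_bigl => j; rewrite inE.
  rewrite (ent_cM r_ge0) (bigID (mem D)) /=.
  suff : rsum r D * n%:R - (ntx C i)%:R <= \sum_(j in D) log2 #|msg n r j|%:R.
    by move: le1; lra.
  apply: (@le_trans _ _ (\sum_(j in D) (n%:R * rate r j - 1))).
    rewrite sumrB -mulr_sumr mulrC lerD2l lerN2 sumr_const ler_nat.
    by rewrite -[leqRHS]card_ord max_card.
  by apply: ler_sum => j _; rewrite card_ord; case/andP: (log2_nmsg n (r_ge0 j)).
have hF : cent pW M (bY c i) <= 1 + error_prob c * (n%:R * rsum r [set: 'I_(ntx C i)]%SET).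
  apply: le_trans (fano (is_pmf_block r_ge0 c) M (bY c i) (bdec c (i:=i))) _.
  rewrite lerD2l ler_pM //.
  - by apply: sumr_ge0 => w _; exact: p0.
  - by rewrite log2_ge0 // ler1n -(ltr0n R) card_cmsgs_gt0.
  - exact: block_error.
  - rewrite card_dffunR log2_prod => [|j _]; last by rewrite ltr0n msg_gt0.
    rewrite /rsum mulr_sumr [leRHS](eq_bigl xpredT) => [|j]; last by rewrite inE.
    by apply: ler_sum => j _; rewrite card_ord; case/andP: (log2_nmsg n (r_ge0 j)).
(* X drops out as it lives in the other cell. What remains is I(M; T^n), equal to I(M; S^n) because
   T^n and S^n have the same joint law with M. *)
have hG : ent pW G - cent pW G (fun w => (M w, X w)) <= (if a then excess i else 0).
  have -> : cent pW G (fun w => (M w, X w)) = cent pW G M.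
    rewrite /cent (ent_cells pp (@cM _ _ _ _ i) (fun w => opt b (cM w (tx1 C (~~ i))))).
    rewrite (_ : ent pW _ = ent pW (fun w => ((G w, M w), X w))); last first.
      by apply: ent_equiv => w w'; rewrite !xpair_eqE andbA.
    rewrite (ent_cells pp (fun w => (opt a (cT w), cM w))
      (fun w => opt b (cM w (tx1 C (~~ i))))).
    rewrite -(ent_cell pp (fun w => (opt a (cT w), cM w))) -(ent_cell pp (@cM _ _ _ _ i)).
    by rewrite opprD addrACA subrr addr0.
  rewrite /G; case: (a) => /=; last first.
    by rewrite ent_const ?cent_const ?subrr //; exact: is_pmf_block.
  rewrite (@cent_equiv _ _ _ _ _ _ _ _ _ (fun w : W => cT (w i)) M) //.
  rewrite (cent_cell_same (@cT _ _ _ _ i) (@cM _ _ _ _ i)) cent_cTM //.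
  rewrite (@ent_equiv _ _ _ _ _ _ (fun w : W => cT (w i))) //.
  rewrite (ent_cell pp (@cT _ _ _ _ i)) ent_cT // /excess.
  by rewrite lerD2l lerN2 cent_cSM.
(* G and M live in cell i and drop out. If X is revealed, conditioning further on all messages of
   the other cell gives [letter_S]; otherwise the full H(S^n) is left, which is [letter_S] plus the
   excess. *)
have hS : (if b then 0 else excess (~~ i)) + letter_S c (~~ i) <=
    cent pW S (fun w => (G w, M w, X w)).
  have -> : cent pW S (fun w => (G w, M w, X w)) = cent pW S X.
    rewrite /cent (ent_cells pp (fun w => (opt a (cT w), cM w))
      (fun w => opt b (cM w (tx1 C (~~ i))))).
    rewrite (_ : ent pW _ = ent pW (fun w => ((G w, M w), (S w, X w)))); last first.
      apply: ent_equiv => w w'; rewrite !xpair_eqE.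
      by rewrite andbCA.
    rewrite (ent_cells pp (fun w => (opt a (cT w), cM w))
      (fun w => (cS w, opt b (cM w (tx1 C (~~ i)))))).
    rewrite -(ent_cell pp (fun w => (cS w, opt b (cM w (tx1 C (~~ i)))))).
    rewrite -(ent_cell pp (fun w => opt b (cM w (tx1 C (~~ i))))).
    by rewrite opprD addrACA subrr add0r.
  rewrite /X; case: (b) => /=; last first.
    rewrite (@cent_equiv _ _ _ _ _ _ _ _ _ S (fun=> tt)) //.
    rewrite (cent_tt (is_pmf_block r_ge0 c)) (ent_cell pp (@cS _ _ _ _ (~~ i))).
    by rewrite /excess subrK.
  rewrite add0r; apply: le_trans (cent_cSM r_ge0 c (~~ i)) _.
  rewrite -(cent_cell_same (@cS _ _ _ _ (~~ i)) (@cM _ _ _ _ (~~ i))).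
  by apply: cent_coarsen => // w w' ->.
(* The letters at time t are functions of the revealed blocks, as each message determines its
   codeword. *)
have hY : cent pW (bY c i) (fun w => (G w, M2 w, X w)) <=
    \sum_t cent pW (lY i \o bletter t) (lcond a b D \o bletter t).
  apply: le_trans (cent_vector p0 (Vt := fun t => lcond a b D \o bletter t) _ _ _) _ => //.
    move=> t w w' [eG eM eX]; rewrite /lcond /=; congr (_, _, _).
    - by move: eG; rewrite /G /lT /=; case: (a) => //= -[]; rewrite !ffunE => ->.
    - apply/ffunP => j; rewrite !ffunE /lX /= !ffunE.
      by move/ffunP/(_ j): eM; rewrite !ffunE => ->.
    - by move: eX; rewrite /X /lX /=; case: (b) => //= -[]; rewrite !ffunE => ->.
  apply: ler_sum => t _; rewrite le_eqVlt; apply/orP; left; apply/eqP.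
  apply: cent_equiv => // w w' _.
  by rewrite /lY /output /= !ffunE.
have -> : \sum_t letter_bound (block_px t) a b D =
    \sum_t cent pW (lY i \o bletter t) (lcond a b D \o bletter t) - letter_S c (~~ i).
  rewrite /letter_S -sumrB; apply: eq_bigr => t _; rewrite /letter_bound.
  rewrite -!(eq_cent_law _ _ (law_bletter t)) !cent_law; congr (_ - _).
  rewrite -(cent_cell_same (fun w => cS w t) (fun w => cX c (cM w) t (tx1 C (~~ i)))).
  by apply: cent_equiv => w w'; rewrite /lX /lS /= !ffunE.
rewrite [rsum r D * _]mulrC in hM; move: hM hF hG hS hY; lra.
Qed.

End BlockBound.

(** * Bounded time sharing and limits of distributions *)

Section Caratheodory.
Variables (R : realType) (K : finType).

(** The added points have weight zero and repeat the point [q0]. *)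
Lemma is_pmf_pad (N M : nat) (w : 'I_N -> R) (g : 'I_N -> K -> R) :
  (N <= M)%N -> is_pmf w ->
  exists (w' : 'I_M -> R) (sigma : 'I_M -> 'I_N), is_pmf w' /\
    forall k, \sum_q w' q * g (sigma q) k = \sum_q w q * g q k.
Proof.
move=> NM pw; have [w0 w1] := pw.
have /card_gt0P [q0 _] := pmf_card_gt0 pw.
pose W (q : nat) := if insub q is Some q' then w q' else 0.
pose s (q : nat) : 'I_N := insubd q0 q.
have sumW (F : 'I_N -> R) : \sum_(q < M) W q * F (s q) = \sum_q w q * F q.
  transitivity (\sum_(q < N) W q * F (s q)).
    rewrite (big_ord_widen M (fun q => W q * F (s q)) NM) [RHS]big_mkcond /=.
    apply: eq_bigr => q _; case: ifP => // /negbT qN.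
    by rewrite /W insubN ?mul0r.
  by apply: eq_bigr => q _; rewrite /W /s /insubd valK.
exists (fun q => W q), (fun q => s q); split=> [|k]; last exact: sumW.
split=> [q|]; first by rewrite /W; case: insub.
have := sumW (fun=> 1); under eq_bigr do rewrite mulr1.
by move=> ->; under eq_bigr do rewrite mulr1.
Qed.

(** A nonzero left kernel vector of the matrix with rows (g q, 1). The column of ones makes its
    entries sum to zero, so one of them is positive. *)
Lemma affine_dependence (N : nat) (g : 'I_N -> K -> R) : (#|K|.+1 < N)%N ->
  exists v : 'I_N -> R, [/\ exists q, 0 < v q, \sum_q v q = 0 &
    forall k, \sum_q v q * g q k = 0].
Proof.
move=> KN.
pose A := \matrix_(q < N, k < #|K|.+1)
  (if unlift ord_max k is Some k' then g q (enum_val k') else 1) : 'M[R]_(_, _).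
have kA : kermx A != 0.
  rewrite kermx_eq0 /row_free; apply/negP => /eqP rA.
  by have := rank_leq_col A; rewrite rA leqNgt KN.
set u := nz_row (kermx A).
have u0 : u != 0 by rewrite nz_row_eq0.
have uA : u *m A = 0 by apply/sub_kermxP; exact: nz_row_sub.
have usum : \sum_q u 0 q = 0.
  transitivity ((u *m A) 0 ord_max); last by rewrite uA mxE.
  by rewrite mxE; apply: eq_bigr => q _; rewrite mxE unlift_none mulr1.
exists (fun q => u 0 q); split=> [||k] //; last first.
  transitivity ((u *m A) 0 (lift ord_max (enum_rank k))); last by rewrite uA mxE.
  by rewrite mxE; apply: eq_bigr => q _; rewrite mxE liftK enum_rankK.
apply/existsP; move: u0; apply: contraR => /existsPn upos.
have un q : 0 <= - u 0 q by rewrite oppr_ge0 leNgt.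
apply/eqP/matrixP => i q; rewrite ord1 mxE.
have : \sum_q - u 0 q = 0 by rewrite sumrN usum oppr0.
move/eqP; rewrite psumr_eq0 // => /allP /(_ q (mem_index_enum _)).
by rewrite oppr_eq0 => /eqP.
Qed.

(* Moving along an affine dependence until a weight vanishes removes one
   point. *)
Lemma caratheodory (N : nat) (w : 'I_N -> R) (g : 'I_N -> K -> R) :
  is_pmf w ->
  exists (w' : 'I_#|K|.+1 -> R) (sigma : 'I_#|K|.+1 -> 'I_N), is_pmf w' /\
    forall k, \sum_q w' q * g (sigma q) k = \sum_q w q * g q k.
Proof.
elim: N w g => [|N IH] w g pw.
  by have := pmf_card_gt0 pw; rewrite card_ord.
have [NK|KN] := leqP N.+1 #|K|.+1; first exact: is_pmf_pad.
have [v [[q1 vq1] vsum vg]] := affine_dependence g KN.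
have [w0 w1] := pw.
(* The least ratio w/v over v > 0 is the longest step that keeps all weights nonnegative, and it
   makes the weight of [q0] zero. *)
case: (@arg_minP _ _ _ q1 (fun q => 0 < v q) (fun q => w q / v q) vq1) => q0 vq0 qmin.
pose t := w q0 / v q0.
have t0 : 0 <= t by rewrite divr_ge0 // ltW.
pose w2 q := w q - t * v q.
have w20 q : 0 <= w2 q.
  rewrite subr_ge0; have [vq|vq] := ltP 0 (v q).
    by rewrite -ler_pdivlMr // qmin.
  by rewrite (le_trans _ (w0 q)) // mulr_ge0_le0.
have w2q0 : w2 q0 = 0 by rewrite /w2 /t divfK ?subrr // gt_eqF.
have sum_w2 (F : 'I_N.+1 -> R) : \sum_q v q * F q = 0 ->
    \sum_q w2 (lift q0 q) * F (lift q0 q) = \sum_q w q * F q.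
  move=> vF; transitivity (\sum_q w2 q * F q).
    by rewrite (bigD1_ord q0) //= w2q0 mul0r add0r.
  rewrite /w2; under eq_bigr do rewrite mulrBl -mulrA.
  by rewrite sumrB -mulr_sumr vF mulr0 subr0.
have pw3 : is_pmf (fun q => w2 (lift q0 q)).
  split=> [q //|].
  transitivity (\sum_q w2 (lift q0 q) * 1); first by apply: eq_bigr => q _; rewrite mulr1.
  rewrite (sum_w2 (fun=> 1)) -?[RHS]w1; first by apply: eq_bigr => q _; rewrite mulr1.
  by rewrite -[RHS]vsum; apply: eq_bigr => q _; rewrite mulr1.
have [w' [s [pw' sE]]] := IH _ (fun q => g (lift q0 q)) pw3.
exists w', (fun q => lift q0 (s q)); split=> // k.
by rewrite sE (sum_w2 (fun q => g q k)).
Qed.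

End Caratheodory.

(** * Limits along an ultrafilter *)

Section Limits.
Variables (R : realType) (F : set_system nat).
Context {FU : UltraFilter F}.

(** Compactness gives a cluster point. If the preimage of one of its neighbourhoods were not in the
    ultrafilter, the complement would be, contradicting clustering. *)
Lemma ultra_cvg (u : nat -> R) : (forall k, 0 <= u k <= 1) ->
  exists l : R, u @ F --> l.
Proof.
move=> u01; have := @segment_compact R 0 1.
move=> /(_ (u @ F) _) [|p [_ cp]].
  by apply: (@filterS _ F _ setT) => [k _ |]; [rewrite /= in_itv /= u01 | exact: filterT].
exists p => B Bp; case: (in_ultra_setVsetC (u @^-1` B) FU) => // nB.
by have [x [/= nBx Bx]] := cp (~` B) B nB Bp.
Qed.

(** Follows from ln y <= y at y = 1 / sqrt x. It controls x ln x near 0, where continuity of the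
    logarithm is of no help. *)
Lemma mul_ln_bound (x : R) : 0 <= x <= 1 -> `|x * ln x| <= 2 * Num.sqrt x.
Proof.
case/andP; rewrite le_eqVlt => /predU1P [<- _|x0 x1].
  by rewrite mul0r normr0 mulr_ge0.
have s0 : 0 < Num.sqrt x by rewrite sqrtr_gt0.
have xE : x = Num.sqrt x ^+ 2 by rewrite sqr_sqrtr // ltW.
have l0 : ln x <= 0 by rewrite ln_le0.
have ls : ln (Num.sqrt x)^-1 <= (Num.sqrt x)^-1.
  by apply/ltW/ln_sublinear; rewrite invr_gt0.
rewrite normrM (gtr0_norm x0) (ler0_norm l0) {1 2}xE lnXn // expr2.
rewrite lnV ?posrE // in ls.
have h : Num.sqrt x * - ln (Num.sqrt x) <= 1 by rewrite -ler_pdivlMl // mulr1.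
rewrite [leLHS](_ : _ = 2 * Num.sqrt x * (Num.sqrt x * - ln (Num.sqrt x))); last by ring.
by rewrite -[leRHS]mulr1 ler_pM2l // mulr_gt0.
Qed.

Lemma cvg_mul_log2 (u : nat -> R) (l : R) : (forall k, 0 <= u k) ->
  u @ F --> l -> (fun k => u k * log2 (u k)) @ F --> l * log2 l.
Proof.
move=> u0 ul.
have l0 : 0 <= l by apply: (cvgr_to_ge ul); exact: nearW.
suff H : (fun k => u k * ln (u k)) @ F --> l * ln l.
  rewrite /log2 mulrA; under eq_cvg do rewrite /log2 mulrA.
  by apply: cvgM => //; exact: cvg_cst.
move: l0; rewrite le_eqVlt => /predU1P [l0|l0]; last first.
  apply: cvgM => //; apply: continuous_cvg => //; exact: continuous_ln.
rewrite -l0 mul0r in ul *.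
have s0 : (fun k => 2 * Num.sqrt (u k)) @ F --> 2 * Num.sqrt (0 : R).
  apply: cvgM; first exact: cvg_cst.
  by apply: continuous_cvg => //; exact: sqrt_continuous.
rewrite sqrtr0 mulr0 in s0.
have sN : (fun k => - (2 * Num.sqrt (u k))) @ F --> - (0 : R) by exact: cvgN.
rewrite oppr0 in sN.
apply: (squeeze_cvgr _ sN s0).
apply: filterS (cvgr_le _ ul _ ltr01) => k uk.
by rewrite -ler_norml mul_ln_bound // u0 uk.
Qed.

Lemma cvg_sumr (I : finType) (P : pred I) (f : I -> nat -> R) (a : I -> R) :
  (forall i, P i -> f i @ F --> a i) ->
  (fun k => \sum_(i | P i) f i k) @ F --> \sum_(i | P i) a i.
Proof. by move=> fa; apply: cvg_big => //; exact: add_continuous. Qed.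

Lemma cvg_prodr (I : finType) (P : pred I) (f : I -> nat -> R) (a : I -> R) :
  (forall i, P i -> f i @ F --> a i) ->
  (fun k => \prod_(i | P i) f i k) @ F --> \prod_(i | P i) a i.
Proof. by move=> fa; apply: cvg_big => //; exact: mul_continuous. Qed.

Lemma cvg_ent (W A : finType) (p : nat -> W -> R) (q : W -> R) (U : W -> A) :
  (forall k w, 0 <= p k w) -> (forall w, (p ^~ w) @ F --> q w) ->
  (fun k => ent (p k) U) @ F --> ent q U.
Proof.
move=> p0 pq; rewrite entE; under eq_cvg do rewrite entE.
apply: cvgN; apply: cvg_sumr => a _.
by apply: cvg_mul_log2 => [k|]; [exact: law_ge0 | exact: cvg_sumr].
Qed.

Lemma cvg_cent (W A B : finType) (p : nat -> W -> R) (q : W -> R)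
    (U : W -> A) (V : W -> B) :
  (forall k w, 0 <= p k w) -> (forall w, (p ^~ w) @ F --> q w) ->
  (fun k => cent (p k) U V) @ F --> cent q U V.
Proof. by move=> p0 pq; apply: cvgB; apply: cvg_ent. Qed.

Lemma is_pmf_lim (A : finType) (p : nat -> A -> R) (q : A -> R) :
  (forall k, is_pmf (p k)) -> (forall a, (p ^~ a) @ F --> q a) -> is_pmf q.
Proof.
move=> pp pq; split=> [a|].
  by apply: (cvgr_to_ge (pq a)); apply: nearW => k; case: (pp k).
have : (fun k => \sum_a p k a) @ F --> \sum_a q a by apply: cvg_sumr.
rewrite (_ : (fun k => _) = fun=> 1).
  by move/cvg_unique; apply => //; exact: cvg_cst.
by apply/funext => k; case: (pp k).
Qed.

Lemma pmf_cvg (A : finType) (p : nat -> A -> R) : (forall k, is_pmf (p k)) ->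
  exists q, is_pmf q /\ forall a, (p ^~ a) @ F --> q a.
Proof.
move=> pp; have H a : {l : R | (p ^~ a) @ F --> l}.
  apply/cid/ultra_cvg => k; have [p0 p1] := pp k; rewrite p0 -p1 (bigD1 a) //=.
  by rewrite lerDl sumr_ge0.
exists (fun a => projT1 (H a)); have Hc a := projT2 (H a).
by split=> //; apply: is_pmf_lim pp _.
Qed.

End Limits.

(** * The outer region *)

Section Mixture.
Variables (R : realType) (Q L : finType) (w : Q -> R) (p : Q -> L -> R).
Hypotheses (pw : is_pmf w) (pp : forall q, is_pmf (p q)).

Let mix (x : Q * L) : R := w x.1 * p x.1 x.2.

Lemma law_mix (A : finType) (U : L -> A) a q :
  law mix (fun x => (U x.2, x.1)) (a, q) = w q * law (p q) U a.
Proof.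
rewrite /law mulr_sumr (eq_bigl (fun x => (x.1 == q) && (U x.2 == a))); last first.
  by move=> x; rewrite xpair_eqE andbC.
rewrite -(pair_big (pred1 q) (fun l => U l == a) (fun q l => w q * p q l)) /=.
by rewrite big_pred1_eq.
Qed.

(** The chain rule H(U,Q) = H(U|Q) + H(Q); the term H(Q) cancels in [cent_mix]. *)
Lemma ent_mix (A : finType) (U : L -> A) :
  ent mix (fun x => (U x.2, x.1)) =
  \sum_q w q * ent (p q) U - \sum_q w q * log2 (w q).
Proof.
have [w0 _] := pw.
rewrite -sumrB /ent -(pair_big xpredT xpredT (fun q l => mix (q, l) *
  log2 (law mix (fun x => (U x.2, x.1)) (U l, q)))) /= -sumrN.
apply: eq_bigr => q _; have [p0 p1] := pp q.
rewrite mulrN -opprD; congr (- _).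
rewrite -[X in _ + X]mul1r -p1 mulr_suml mulr_sumr -big_split /=.
apply: eq_bigr => l _; rewrite law_mix /mix /=.
have := w0 q; rewrite le_eqVlt => /predU1P [<-|wq]; first by rewrite !mul0r mulr0 addr0.
have := p0 l; rewrite le_eqVlt => /predU1P [<-|pl]; first by rewrite !(mulr0, mul0r) addr0.
rewrite log2M // ?(law_gt0 p0 _ pl) //; ring.
Qed.

Lemma cent_mix (A B : finType) (U : L -> A) (V : L -> B) :
  cent mix (fun x => U x.2) (fun x => (V x.2, x.1)) = \sum_q w q * cent (p q) U V.
Proof.
rewrite /cent ent_mix (_ : ent mix _ = ent mix (fun x => ((U x.2, V x.2), x.1))).
  rewrite (ent_mix (fun l => (U l, V l))) opprB addrA subrK -sumrB.
  by apply: eq_bigr => q _; rewrite mulrBr.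
by apply: ent_equiv => x y; rewrite !xpair_eqE andbA.
Qed.

End Mixture.

Section OuterRegion.
Variables (R : realType) (C : sdmac R).

(** Indexes every bound of both cells; its cardinality is the dimension in which Caratheodory's
    theorem is applied. *)
Definition bound_index : finType :=
  (bool * bool * {i : bool & {set 'I_(ntx C i)}})%type.

Definition bidx (a b : bool) i (D : {set 'I_(ntx C i)}) : bound_index :=
  (a, b, Tagged (fun i => {set 'I_(ntx C i)}) D).

Definition bounds (px : input_laws C) (k : bound_index) : R :=
  letter_bound px k.1.1 k.1.2 (tagged k.2).

(* The system defining the region, with [beta] the vector of bounds and slack
   [eps], and with the pairs of inequalities exchanged by swapping the cells
   merged. *)
Definition slack_region (eps : R) (r : rates C) (beta : bound_index -> R) : Prop :=
  [/\ forall i j, - eps <= @rate R C r i j,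
      forall i (O : {set 'I_(ntx C i)}), rsum r O <= beta (bidx false true O) + eps,
      forall i (U : {set 'I_(ntx C i)}) (O : {set 'I_(ntx C (~~ i))}),
        rsum r U + rsum r O <=
        beta (bidx true true U) + beta (bidx false false O) + eps,
      forall i (U : {set 'I_(ntx C i)}) (V : {set 'I_(ntx C (~~ i))}),
        rsum r U + rsum r V <=
        beta (bidx true false U) + beta (bidx true false V) + eps &
      forall i (U O : {set 'I_(ntx C i)}) (V : {set 'I_(ntx C (~~ i))}),
        rsum r U + rsum r O + rsum r V <=
        beta (bidx true true U) + beta (bidx false false O) +
        beta (bidx true false V) + eps].

Lemma slack_region0 r beta :
  (forall eps, 0 < eps -> slack_region eps r beta) -> slack_region 0 r beta.
Proof.
move=> H; split=> [i j|i O|i U O|i U V|i U O V].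
- rewrite oppr0 -lerN2 oppr0; apply/ler_addgt0Pr => e e0; rewrite add0r.
  by rewrite lerNl; case: (H e e0).
all: rewrite addr0; apply/ler_addgt0Pr => e e0; by case: (H e e0).
Qed.

(** An inequality of the system has at most three bounds and three rate sums, each sum with at most
    as many terms as there are transmitters. *)
Definition slack_const : R := 3 + 3 * ((ntx C false)%:R + (ntx C true)%:R).

Lemma slack_region_perturb eps delta r r' beta beta' : 0 <= delta ->
  (forall i j, `|@rate R C r i j - rate r' j| <= delta) ->
  (forall k, `|beta k - beta' k| <= delta) ->
  slack_region eps r beta -> slack_region (eps + slack_const * delta) r' beta'.
Proof.
move=> d0 rr' bb' [H1 H2 H3 H4 H5].
set N : R := (ntx C false)%:R + (ntx C true)%:R.
have N0 : 0 <= N * delta by rewrite mulr_ge0 // addr_ge0.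
have K1 : slack_const * delta = 3 * delta + 3 * (N * delta).
  by rewrite /slack_const -/N; ring.
have hr i (D : {set 'I_(ntx C i)}) : rsum r' D <= rsum r D + N * delta.
  rewrite -lerBlDl /rsum -sumrB.
  apply: (@le_trans _ _ (\sum_(j in D) delta)).
    apply: ler_sum => j _; have := rr' i j; rewrite ler_distlC; case/andP; lra.
  rewrite sumr_const -mulr_natl ler_wpM2r //.
  apply: (@le_trans _ _ (ntx C i)%:R).
    by rewrite ler_nat -[leqRHS]card_ord max_card.
  by rewrite /N; case: (i); rewrite ?lerDl ?lerDr.
have hb k : beta k <= beta' k + delta.
  by have := bb' k; rewrite ler_distl; case/andP; lra.
rewrite K1; split=> [i j|i O|i U O|i U V|i U O V].
- have := H1 i j; have := rr' i j; rewrite ler_distl => /andP [_ h1] h2; lra.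
- have := H2 i O; have := hr _ O; have := hb (bidx false true O); lra.
- have := H3 i U O; have := hr _ U; have := hr _ O.
  have := hb (bidx true true U); have := hb (bidx false false O); lra.
- have := H4 i U V; have := hr _ U; have := hr _ V.
  have := hb (bidx true false U); have := hb (bidx true false V); lra.
- have := H5 i U O V; have := hr _ U; have := hr _ O; have := hr _ V.
  have := hb (bidx true true U); have := hb (bidx false false O).
  have := hb (bidx true false V); lra.
Qed.

Lemma slack_regionW e e' r beta : e <= e' ->
  slack_region e r beta -> slack_region e' r beta.
Proof.
move=> ee' [H1 H2 H3 H4 H5]; split=> [i j|i O|i U O|i U V|i U O V].
- have := H1 i j; lra.
- have := H2 i O; lra.
- have := H3 i U O; lra.
- have := H4 i U V; lra.
- have := H5 i U O V; lra.
Qed.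

Definition mixed_bounds (Q : finType) (w : Q -> R) (px : Q -> input_laws C)
    (k : bound_index) : R :=
  \sum_q w q * bounds (px q) k.

(* The offsets [excess] of the four types of bounds cancel in each of the
   seven inequalities. *)
Lemma achievable_slack r eps : achievable r -> 0 < eps ->
  exists N (w : 'I_N -> R) (px : 'I_N -> input_laws C),
  [/\ is_pmf w, forall q i j, is_pmf (px q i j) &
      slack_region eps r (mixed_bounds w px)].
Proof.
move=> [r0 [c cerr]] e0.
pose N0 : R := (ntx C false)%:R + (ntx C true)%:R + 1.
pose S0 : R := rsum r [set: 'I_(ntx C false)]%SET + rsum r [set: 'I_(ntx C true)]%SET.
have rs0 i (D : {set 'I_(ntx C i)}) : 0 <= rsum r D by apply: sumr_ge0 => j _; exact: r0.
have S00 : 0 <= S0 by rewrite addr_ge0.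
have N00 : 0 < N0 by rewrite ltr_wpDl // addr_ge0.
(* At most three bounds are added, so each may lose eps/3: half goes to the error probability times
   the sum rate, half to the constant terms divided by the block length. The 1 added to [S0] avoids
   dividing by zero. *)
have d0 : 0 < eps / (6 * (S0 + 1)) by rewrite divr_gt0 // mulr_gt0 // ltr_wpDl.
have d1 : 0 < eps / (6 * N0) by rewrite divr_gt0 // mulr_gt0.
have [n [errn nn]] : exists n, error_prob (c n.+1) <= eps / (6 * (S0 + 1)) /\
    n.+1%:R^-1 <= eps / (6 * N0).
  have h1 : \forall n \near \oo, error_prob (c n.+1) <= eps / (6 * (S0 + 1)).
    have /cvgr0Pnorm_le/(_ _ d0) := cerr.
    case=> M _ MP; exists M => // n /= Mn.
    by apply: le_trans (ler_norm _) (MP n.+1 _); rewrite /= (leq_trans Mn).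
  have h2 := near_infty_natSinv_lt (PosNum d1).
  have [n [a b]] := filter_ex (filterI h1 h2).
  by exists n; split=> //; exact: ltW.
have n0 : 0 < n.+1%:R :> R by rewrite ltr0n.
exists n.+1, (fun=> n.+1%:R^-1), (@block_px _ _ _ _ (c n.+1)); split.
- split=> [q|]; first by rewrite invr_ge0.
  by rewrite sumr_const card_ord -[LHS]mulr_natr mulVf // gt_eqF.
- by move=> q i j; exact: is_pmf_block_px.
set beta := mixed_bounds _ _.
pose x i := excess (c n.+1) i / n.+1%:R.
have H a b i (D : {set 'I_(ntx C i)}) : rsum r D <= beta (bidx a b D) +
    (if a then x i else 0) - (if b then 0 else x (~~ i)) + eps / 3.
  have := block_bound r0 (c n.+1) a b D.
  have -> : \sum_t letter_bound (block_px (c n.+1) t) a b D =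
      n.+1%:R * beta (bidx a b D).
    rewrite /beta /mixed_bounds mulr_sumr; apply: eq_bigr => t _.
    by rewrite mulrA divff ?mul1r // gt_eqF.
  have -> : (if a then excess (c n.+1) i else 0) = n.+1%:R * (if a then x i else 0).
    by case: (a); rewrite ?mulr0 // mulrC divfK // gt_eqF.
  have -> : (if b then 0 else excess (c n.+1) (~~ i)) =
      n.+1%:R * (if b then 0 else x (~~ i)).
    by case: (b); rewrite ?mulr0 // mulrC divfK // gt_eqF.
  move=> h; rewrite -(ler_pM2l n0); apply: le_trans h _.
  rewrite !mulrDr mulrN lerD2l.
  have nle : (ntx C i)%:R + 1 <= n.+1%:R * (eps / 6).
    apply: (@le_trans _ _ N0).
      by rewrite lerD2r; case: (i); rewrite ?lerDl ?lerDr.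
    rewrite -[leLHS](mulVKf (lt0r_neq0 n0)) ler_pM2l // -ler_pdivlMr //.
    by move: nn; rewrite invfM mulrA.
  have Sle : error_prob (c n.+1) * (n.+1%:R * rsum r [set: 'I_(ntx C i)]%SET) <=
      n.+1%:R * (eps / 6).
    rewrite mulrCA ler_pM2l //.
    have S1 : 0 < S0 + 1 by rewrite ltr_wpDl.
    apply: (@le_trans _ _ (eps / (6 * (S0 + 1)) * (S0 + 1))).
      have SS : rsum r [set: 'I_(ntx C i)]%SET <= S0 + 1.
        rewrite ler_wpDr // /S0; by case: (i); rewrite ?lerDl ?lerDr.
      apply: (@le_trans _ _ (eps / (6 * (S0 + 1)) * rsum r [set: 'I_(ntx C i)]%SET)).
        by rewrite ler_wpM2r.
      by rewrite ler_wpM2l // ltW.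
    by rewrite invfM mulrA divfK // gt_eqF.
  have -> : n.+1%:R * (eps / 3) = n.+1%:R * (eps / 6) + n.+1%:R * (eps / 6) by lra.
  by rewrite lerD.
split=> [i j|i O|i U O|i U V|i U O V].
- by apply: le_trans (r0 i j); rewrite oppr_le0 ltW.
- have := H false true i O; lra.
(* Seen from cell i' the offset is that of [~~ ~~ i]; [negbK] turns it into that of i, and the
   offsets cancel. *)
- have := H true true i U; have := H false false _ O; rewrite negbK; lra.
- have := H true false i U; have := H true false _ V; rewrite negbK; lra.
- have := H true true i U; have := H false false i O; have := H true false _ V.
  rewrite negbK; lra.
Qed.

(** Here the alphabet of Q no longer depends on [eps]. Half of the slack absorbs the distance to an
    achievable tuple, half the finite block length. *)
Lemma capacity_slack r eps : capacity_region C r -> 0 < eps ->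
  exists (w : 'I_#|bound_index|.+1 -> R) (px : 'I_#|bound_index|.+1 -> input_laws C),
  [/\ is_pmf w, forall q i j, is_pmf (px q i j) &
      slack_region eps r (mixed_bounds w px)].
Proof.
move=> rC e0.
have K0 : 0 < slack_const by rewrite ltr_wpDr // mulr_ge0 // addr_ge0.
pose d := eps / (2 * slack_const).
have d0 : 0 < d by rewrite divr_gt0 // mulr_gt0.
have [r' [ar' rr']] : exists r', achievable r' /\
    forall i j, `|@rate R C r' i j - rate r j| <= d.
  have [r' [ar' [b1 b2]]] := rC _ (nbhsx_ballx r d d0).
  exists r'; split=> // -[] j; rewrite distrC ltW //=.
    by case: b2 => _ /(_ ord0 j).
  by case: b1 => _ /(_ ord0 j).
have [N [w [px [pw ppx sl]]]] := achievable_slack ar' (divr_gt0 e0 (ltr0n _ 2)).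
have [w' [s [pw' E]]] := caratheodory (fun q => bounds (px q)) pw.
exists w', (fun q => px (s q)); split=> //.
have := @slack_region_perturb _ d _ r _ (mixed_bounds w' (fun q => px (s q)))
  (ltW d0) rr' _ sl.
have -> : eps / 2 + slack_const * d = eps.
  by rewrite /d; field; exact: lt0r_neq0.
apply=> k; rewrite /mixed_bounds E subrr normr0; exact: ltW.
Qed.

Lemma letter_law_ge0 (px : input_laws C) : (forall i j, is_pmf (px i j)) ->
  forall w, 0 <= letter_law px w.
Proof.
move=> ppx w; apply: mulr_ge0; apply: prodr_ge0 => i _; last exact: pS_ge0.
by rewrite mulr_ge0 ?pS_ge0 // prodr_ge0 // => j _; case: (ppx i j).
Qed.

Lemma is_pmf_letter_law (px : input_laws C) : (forall i j, is_pmf (px i j)) ->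
  is_pmf (letter_law px).
Proof.
move=> ppx; split; first exact: letter_law_ge0.
rewrite -(pair_big xpredT xpredT (fun tx s => letter_law px (tx, s))) /=.
rewrite -(pair_big xpredT xpredT (fun t x => \sum_s letter_law px ((t, x), s))) /=.
rewrite exchange_big /=.
transitivity (\sum_(x : input C) \prod_i \prod_(j < ntx C i) px i j (x i j)).
  apply: eq_bigr => x _.
  transitivity (\sum_(t : svec C) \prod_i (pS (x i (tx1 C i)) (t i) *
      \prod_(j < ntx C i) px i j (x i j))).
    apply: eq_bigr => t _; rewrite /letter_law /= -mulr_sumr -[RHS]mulr1; congr (_ * _).
    rewrite /pSS (sum_dffun_prod (fun i s => pS (x i (tx1 C i)) s)) big1 // => i _.
    exact: sum_pS.
  rewrite (sum_dffun_prod (fun i t => pS (x i (tx1 C i)) t *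
      \prod_(j < ntx C i) px i j (x i j))).
  by apply: eq_bigr => i _; rewrite -mulr_suml sum_pS mul1r.
rewrite (sum_dffun_prod (fun i (x : cell_input C i) => \prod_(j < ntx C i) px i j (x j))).
rewrite big1 // => i _; rewrite (sum_dffun_prod (px i)) big1 // => j _.
by case: (ppx i j).
Qed.

Lemma cvg_mixed_bounds (F : set_system nat) (FU : UltraFilter F) (Q : finType)
    (w : nat -> Q -> R) (px : nat -> Q -> input_laws C) ws pxs :
  (forall k q i j, is_pmf (px k q i j)) ->
  (forall q, (w ^~ q) @ F --> (ws q : R)) ->
  (forall q i j x, (fun k => px k q i j x) @ F --> (pxs q i j x : R)) ->
  forall k, (fun n => mixed_bounds (w n) (px n) k) @ F --> mixed_bounds ws pxs k.
Proof.
move=> ppx wc pxc k; apply: cvg_sumr => q _; apply: cvgM; first exact: wc.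
have lc y : (fun n => letter_law (px n q) y) @ F --> letter_law (pxs q) y.
  apply: cvgM; last exact: cvg_cst.
  apply: cvg_prodr => i _; apply: cvgM; first exact: cvg_cst.
  by apply: cvg_prodr => j _; exact: pxc.
by apply: cvgB; apply: cvg_cent => // n y; exact: letter_law_ge0.
Qed.

Lemma capacity_exact r : capacity_region C r ->
  exists (Q : finType) (w : Q -> R) (px : Q -> input_laws C),
  [/\ is_pmf w, forall q i j, is_pmf (px q i j) &
      slack_region 0 r (mixed_bounds w px)].
Proof.
move=> rC; have k0 k : 0 < k.+1%:R^-1 :> R by rewrite invr_gt0.
pose Q : finType := 'I_#|bound_index|.+1.
have /choice [wp wpP] : forall k : nat, exists wp : (Q -> R) * (Q -> input_laws C),
    [/\ is_pmf wp.1, forall q i j, is_pmf (wp.2 q i j) &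
        slack_region k.+1%:R^-1 r (mixed_bounds wp.1 wp.2)].
  by move=> k; have [w [px H]] := capacity_slack rC (k0 k); exists (w, px).
(* One ultrafilter serves all weights and input laws at once, with no successive extraction of
   subsequences. It refines the filter at infinity, so the slacks still tend to 0 along it. *)
have [F [FU oF]] := ultraFilterLemma eventually_filter.
have [ws [pws wsc]] := @pmf_cvg R F FU _ (fun k => (wp k).1)
  (fun k => let: And3 h _ _ := wpP k in h).
have pc (q : Q) i (j : 'I_(ntx C i)) := @pmf_cvg R F FU _
  (fun k => (wp k).2 q i j) (fun k => let: And3 _ h _ := wpP k in h q i j).
pose pxs q i j := projT1 (cid (pc q i j)).
have [ppxs pxsc] : (forall q i j, is_pmf (pxs q i j)) /\
    (forall q i j x, (fun k => (wp k).2 q i j x) @ F --> pxs q i j x).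
  by split=> q i j; have [] := projT2 (cid (pc q i j)).
exists Q, ws, pxs; split=> //.
have bc := @cvg_mixed_bounds F FU Q (fun k => (wp k).1) (fun k => (wp k).2) ws pxs
  (fun k => let: And3 _ h _ := wpP k in h) wsc pxsc.
apply: slack_region0 => eps e0.
have K0 : 0 < 1 + slack_const.
  by rewrite ltr_wpDr // addr_ge0 // mulr_ge0 // addr_ge0.
pose d := eps / (1 + slack_const).
have d0 : 0 < d by rewrite divr_gt0.
have h1 : \forall n \near F, n.+1%:R^-1 <= d.
  by apply: filterS (oF _ (near_infty_natSinv_lt (PosNum d0))) => n /= /ltW.
have h2 : \forall n \near F, forall k,
    `|mixed_bounds (wp n).1 (wp n).2 k - mixed_bounds ws pxs k| <= d.
  (* Finiteness of [bound_index] makes the convergence uniform in k. *)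
  apply: filter_forall => k.
  have /cvgrPdist_le/(_ _ d0) := bc k; apply: filterS => n /=.
  by rewrite distrC.
have [n [n1 n2]] := filter_ex (filterI h1 h2).
have [_ _ sl] := wpP n.
have := slack_region_perturb (ltW d0) _ n2 (slack_regionW n1 sl).
rewrite (_ : d + slack_const * d = eps); last first.
  by rewrite -{1}[d]mul1r -mulrDl mulrC divfK // gt_eqF.
by apply=> i j; rewrite subrr normr0 ltW.
Qed.

Section TimeSharing.
Variables (Q : finType) (w : Q -> R) (px : Q -> input_laws C).
Hypotheses (pw : is_pmf w) (ppx : forall q i j, is_pmf (@px q i j)).

Definition mixed_Po (v : po_space C Q) : R :=
  w v.1.1 * \prod_(i : bool) (pS (v.2 i (tx1 C i)) (v.1.2 i) *
    \prod_(j < ntx C i) @px v.1.1 i j (v.2 i j)).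

(** Under [full_law] the letters are a mixture of the letter laws, up to the reordering of
    components done by [phi]; conditioning on Q averages the entropies. *)
Lemma cent_full_law (A B : finType) (U : letter C -> A) (V : letter C -> B) :
  cent (full_law mixed_Po) (fun v => U (v.1.1.2, v.1.2, v.2))
    (fun v => (V (v.1.1.2, v.1.2, v.2), rvQ v)) =
  \sum_q w q * cent (letter_law (px q)) U V.
Proof.
rewrite -(cent_mix pw (fun q => is_pmf_letter_law (ppx q))).
pose phi (x : Q * letter C) : full_space C Q := (x.1, x.2.1.1, x.2.1.2, x.2.2).
rewrite -(eq_cent_law _ _
  (p := law (fun x : Q * letter C => w x.1 * letter_law (px x.1) x.2) phi)).
  rewrite cent_law; apply: cent_equiv => x y //=.
    by case: x => ? [[? ?] ?]; case: y => ? [[? ?] ?].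
  by move=> _; case: x => ? [[? ?] ?]; case: y => ? [[? ?] ?].
case=> [[[q t] x] s]; rewrite /law (big_pred1 (q, (t, x, s))).
  by rewrite /full_law /mixed_Po /letter_law /= mulrA.
case=> q' [[t' x'] s'] /=; rewrite -pair_eqE /phi /=.
by rewrite !xpair_eqE !andbA.
Qed.

Lemma full_law_ge0 v : 0 <= full_law mixed_Po v.
Proof.
rewrite /full_law /mixed_Po; have [w0 _] := pw.
rewrite !mulr_ge0 // ?prodr_ge0 // => i _; last exact: pS_ge0.
by rewrite mulr_ge0 ?pS_ge0 // prodr_ge0 // => j _; case: (ppx v.1.1.1 j).
Qed.

Lemma eq_Some (T : eqType) (x y : T) : (Some x == Some y) = (x == y).
Proof. by []. Qed.

Lemma mixed_boundsE a b i (D : {set 'I_(ntx C i)}) :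
  mixed_bounds w px (bidx a b D) =
  centropy (full_law mixed_Po) (@rvY _ _ _ i)
    (fun v => ((opt a (rvT i v), rvXS (~: D) v, opt b (rvX (tx1 C (~~ i)) v)), rvQ v))
  - HS mixed_Po (~~ i).
Proof.
rewrite /HS !(centropyE _ _ full_law_ge0).
have -> := cent_full_law (lY i) (lcond a b D).
have -> := cent_full_law (lS (~~ i)) (lX (tx1 C (~~ i))).
by rewrite -sumrB; apply: eq_bigr => q _; rewrite -mulrBr.
Qed.

Lemma mixed_Ro r : slack_region 0 r (mixed_bounds w px) -> Ro mixed_Po r.
Proof.
have EA i (D : {set 'I_(ntx C i)}) : bndA mixed_Po D = mixed_bounds w px (bidx true true D).
  rewrite mixed_boundsE; congr (_ - _); rewrite !(centropyE _ _ full_law_ge0).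
  (* Wrapping components in [opt] does not change the partition; splitting on each equality test
     proves it. *)
  by apply: cent_equiv => // v v'; rewrite !xpair_eqE ?eqxx ?eq_Some /=; do !case: (_ == _).
have EB i (D : {set 'I_(ntx C i)}) : bndB mixed_Po D = mixed_bounds w px (bidx false true D).
  rewrite mixed_boundsE; congr (_ - _); rewrite !(centropyE _ _ full_law_ge0).
  by apply: cent_equiv => // v v'; rewrite !xpair_eqE ?eqxx ?eq_Some /=; do !case: (_ == _).
have EE i (D : {set 'I_(ntx C i)}) : bndE mixed_Po D = mixed_bounds w px (bidx true false D).
  rewrite mixed_boundsE; congr (_ - _); rewrite !(centropyE _ _ full_law_ge0).
  by apply: cent_equiv => // v v'; rewrite !xpair_eqE ?eqxx ?eq_Some /=; do !case: (_ == _).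
have EG i (D : {set 'I_(ntx C i)}) : bndG mixed_Po D = mixed_bounds w px (bidx false false D).
  rewrite mixed_boundsE; congr (_ - _); rewrite !(centropyE _ _ full_law_ge0).
  by apply: cent_equiv => // v v'; rewrite !xpair_eqE ?eqxx ?eq_Some /=; do !case: (_ == _).
case=> H1 H2 H3 H4 H5; split; first by move=> i j; have := H1 i j; rewrite oppr0.
move=> U1 O1 U2 O2 _ _ _ _; rewrite !EA !EB !EE !EG.
(* Each inequality with the cells exchanged is the merged clause taken at i = [true]. *)
have := H2 _ O1; have := H2 _ O2; have := H3 false U1 O2; have := H3 true U2 O1.
have := H4 false U1 U2; have := H5 false U1 O1 U2; have := H5 true U2 O2 U1.
move=> /= *; split; [lra|lra|lra|lra|split; lra].
Qed.

End TimeSharing.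
End OuterRegion.

Theorem theorem3 (R : realType) (C : sdmac R) :
  capacity_region C `<=` outer_region C.
Proof.
move=> r /capacity_exact [Q [w [px [pw ppx sl]]]].
exists Q, (mixed_Po w px); split; last exact: mixed_Ro.
exists w, (fun i j q => px q i j); split=> // i j q; exact: ppx.
Qed.
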